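(* Let $0<\delta<\infty$, let $\alpha\in[0,d+2)$, and let the kernel be $$\rho_\delta(r)=\frac{2\Gamma(\frac d2+1)(d+2-\alpha)}{\pi^{\frac d2}\,\delta^{d+2-\alpha}\,r^\alpha}\,\chi_{[0,\delta]}(r).$$ Let $$\lambda_\delta(\boldsymbol{k})=\int_{B_\delta(\boldsymbol{0})}\rho_\delta(|\boldsymbol{r}|)\left(e^{\mathrm{i}\boldsymbol{k}\cdot\boldsymbol{r}}-1\right)d\boldsymbol{r}$$ and $k=|\boldsymbol{k}|$. Then $$\lambda_\delta(\boldsymbol{k})=\frac{4\Gamma(\frac d2+1)}{\delta^2}\sum_{n=1}^\infty\frac{(-k^2\delta^2/4)^n}{n!\,\Gamma(n+\frac d2)}\,\frac{d+2-\alpha}{d+2n-\alpha}=-k^2\,{}_2F_3\!\left(\begin{array}{c}1,\ \frac{d+2-\alpha}{2}\\ 2,\ \frac{d+2}{2},\ \frac{d+4-\alpha}{2}\end{array};-\frac{k^2\delta^2}{4}\right).$$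
   Context: Here $d$ is the number of spatial dimensions (any positive integer), $|\cdot|$ is the Euclidean norm, $B_\delta(\boldsymbol{x})$ is the closed Euclidean ball of radius $\delta$ centred at $\boldsymbol{x}$ in $\mathbb{R}^d$, $\chi_{[0,\delta]}$ is the indicator function of $[0,\delta]$, and $\Gamma$ is the gamma function. The numbers $\lambda_\delta(\boldsymbol{k})$, $\boldsymbol{k}\in\mathbb{Z}^d$, are the eigenvalues, on the Fourier modes $e^{\mathrm{i}\boldsymbol{k}\cdot\boldsymbol{x}}$ on the torus $\mathbb{T}^d=[0,2\pi)^d$ (extended periodically to $\mathbb{R}^d$), of the nonlocal diffusion operator $\mathcal{L}_\delta u(\boldsymbol{x})=\int_{B_\delta(\boldsymbol{x})}\rho_\delta(|\boldsymbol{x}-\boldsymbol{y}|)[u(\boldsymbol{y})-u(\boldsymbol{x})]\,d\boldsymbol{y}$. The generalized hypergeometric function is formally defined by its Maclaurin series ${}_pF_q\left(\begin{array}{c}a_1,\dots,a_p\\ b_1,\dots,b_q\end{array};z\right)=\sum_{n=0}^\infty\frac{(a_1)_n\cdots(a_p)_n}{(b_1)_n\cdots(b_q)_n}\frac{z^n}{n!}$, where $(x)_n=\Gamma(x+n)/\Gamma(x)$ is the Pochhammer symbol for the rising factorial. *)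

(* Defs.v *)
From HB Require Import structures.
From mathcomp Require Import all_boot all_order all_algebra.
From mathcomp Require Import complex.
From mathcomp Require Import all_classical all_reals all_analysis.

Set Implicit Arguments.
Unset Strict Implicit.
Unset Printing Implicit Defensive.

Import Order.TTheory GRing.Theory Num.Theory.
Import numFieldNormedType.Exports.

Local Open Scope classical_set_scope.
Local Open Scope ring_scope.
Local Open Scope complex_scope.

(* Points of R^d; the tuple type carries the product (= Borel) sigma-algebra. *)
Notation vec R d := (d.-tuple (measurableTypeR R)).

Section lebesgue_vec_cons.
Context {R : realType} (n : nat).
Variable mu : {sigma_finite_measure set (vec R n) -> \bar R}.

Definition vcons (p : measurableTypeR R * vec R n) : vec R n.+1 :=
  [tuple of p.1 :: p.2].

Lemma measurable_vcons : measurable_fun setT vcons.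
Proof. by apply: measurable_cons; [exact: measurable_fst|exact: measurable_snd]. Qed.

Definition lebesgue_vec_cons : set (vec R n.+1) -> \bar R :=
  pushforward (@lebesgue_measure R \x mu)%E vcons.

Let lebesgue_vec_cons0 : lebesgue_vec_cons set0 = 0%E.
Proof. by rewrite /lebesgue_vec_cons /pushforward preimage_set0 measure0. Qed.

Let lebesgue_vec_cons_ge0 A : (0 <= lebesgue_vec_cons A)%E.
Proof. by apply: measure_ge0; exact: measurable_vcons. Qed.

Let lebesgue_vec_cons_sigma_additive : semi_sigma_additive lebesgue_vec_cons.
Proof. by apply: measure_semi_sigma_additive; exact: measurable_vcons. Qed.

HB.instance Definition _ := isMeasure.Build _ _ _ lebesgue_vec_cons
  lebesgue_vec_cons0 lebesgue_vec_cons_ge0 lebesgue_vec_cons_sigma_additive.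

Let lebesgue_vec_cons_sigma_finite : sigma_finite setT lebesgue_vec_cons.
Proof.
have /sigma_finiteP[F [FT ndF Foo]] := sigma_finiteT (@lebesgue_measure R).
have /sigma_finiteP[G [GT ndG Goo]] := sigma_finiteT mu.
pose uncons (t : vec R n.+1) : measurableTypeR R * vec R n :=
  (thead t, [tuple of behead t]).
have vconsK p : uncons (vcons p) = p.
  case: p => x t; rewrite /uncons /vcons /= theadE; congr pair.
  exact/val_inj.
have muncons : measurable_fun setT uncons.
  by apply/measurable_fun_pairP; split;
    [exact: (measurable_tnth ord0)|exact: measurable_behead].
exists (fun i => uncons @^-1` (F i `*` G i)).
  apply/seteqP; split => // t _.
  have [i _ Fi] : (\bigcup_i F i) (uncons t).1 by rewrite -FT.
  have [j _ Gj] : (\bigcup_i G i) (uncons t).2 by rewrite -GT.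
  exists (maxn i j) => //; split.
  - by move: Fi; exact/subsetPset/ndF/leq_maxl.
  - by move: Gj; exact/subsetPset/ndG/leq_maxr.
move=> i; have [mF muF] := Foo i; have [mG muG] := Goo i; split.
  by rewrite -[X in measurable X]setTI; apply: muncons => //; exact: measurableX.
rewrite /lebesgue_vec_cons /pushforward (_ : _ @^-1` _ = F i `*` G i); last first.
  by apply/funext => p; rewrite /preimage/= -[in RHS](vconsK p).
by rewrite product_measure1E// lte_mul_pinfty// ge0_fin_numE.
Qed.

HB.instance Definition _ := Measure_isSigmaFinite.Build _ _ _ lebesgue_vec_cons
  lebesgue_vec_cons_sigma_finite.

End lebesgue_vec_cons.

(* Lebesgue measure on R^n: the unit point mass on R^0, then iterated products
   along (x, t) |-> x :: t. *)
Fixpoint lebesgue_vec {R : realType} (n : nat) :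
    {sigma_finite_measure set (vec R n) -> \bar R} :=
  match n with
  | 0%N => \d_([tuple] : vec R 0)
  | m.+1 => lebesgue_vec_cons (@lebesgue_vec R m)
  end.

Lemma lebesgue_vec_box (R : realType) (n : nat)
    (A : 'I_n -> set (measurableTypeR R)) : (forall i, measurable (A i)) ->
  lebesgue_vec n [set x | forall i, A i (tnth x i)] =
  (\prod_(i < n) lebesgue_measure (A i))%E.
Proof.
elim: n A => [|n IH] A mA /=.
  by rewrite big_ord0 diracE mem_set// => -[].
rewrite big_ord_recl -IH// /lebesgue_vec_cons /pushforward.
rewrite -product_measure1E//; last first.
  rewrite (_ : [set _ | _] = \bigcap_(i in [set: 'I_n])
      ((fun x : vec R n => tnth x i) @^-1` A (lift ord0 i))).
    apply: fin_bigcap_measurable => // i _; rewrite -[X in measurable X]setTI.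
    exact: measurable_tnth.
  by apply/seteqP; split => [x /= h i _|x h i]; exact: h.
congr (product_measure1 _ _ _).
apply/seteqP; split => -[x t] /= h.
  split => [|i]; first by have := h ord0; rewrite tnth0.
  by have := h (lift ord0 i); rewrite tnthS.
move=> i; case: (unliftP ord0 i) => [j|] ->.
  by rewrite tnthS; exact: h.2.
by rewrite tnth0; exact: h.1.
Qed.

Section euclidean.
Context {R : realType} {d : nat}.
Implicit Types x y : vec R d.

Definition vdot x y : R := \sum_(i < d) (tnth x i : R) * (tnth y i : R).

Definition enorm x : R := Num.sqrt (\sum_(i < d) (tnth x i : R) ^+ 2).

Definition cball0 (r : R) : set (vec R d) := [set x | enorm x <= r].

Definition vec_of_int (k : d.-tuple int) : vec R d :=
  [tuple ((tnth k i)%:~R : R) | i < d].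

End euclidean.

(* Integral over the closed ball of radius delta of a function that may be
   singular at the origin: the Lebesgue integral when it converges absolutely,
   and otherwise the principal value, the limit as eps -> 0+ of the Lebesgue
   integrals over eps < |x| <= delta. *)
Section ball_integral.
Context {R : realType} {d : nat}.
Variables (delta : R) (f : vec R d -> R).

Definition annulus_integral (eps : R) : R :=
  \int[lebesgue_vec d]_(x in cball0 delta `\` cball0 eps) f x.

Definition ball_integral : R :=
  if (lebesgue_vec d).-integrable (cball0 delta) (EFin \o f)
  then \int[lebesgue_vec d]_(x in cball0 delta) f x
  else lim (annulus_integral eps @[eps --> 0^'+]).

Definition ball_integral_exists : Prop :=
  (lebesgue_vec d).-integrable (cball0 delta) (EFin \o f) \/
  (forall eps : R, 0 < eps ->
    (lebesgue_vec d).-integrable (cball0 delta `\` cball0 eps) (EFin \o f)) /\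
  cvg (annulus_integral eps @[eps --> 0^'+]).

End ball_integral.

Section complex_valued.
Context {R : realType} {d : nat}.
Variables (delta : R) (f : vec R d -> R[i]).

Definition complex_ball_integral : R[i] :=
  ball_integral delta (fun x => complex.Re (f x)) +i*
  ball_integral delta (fun x => complex.Im (f x)).

Definition complex_ball_integral_exists : Prop :=
  ball_integral_exists delta (fun x => complex.Re (f x)) /\
  ball_integral_exists delta (fun x => complex.Im (f x)).

End complex_valued.

Section special_functions.
Context {R : realType}.

(* Euler's integral; it represents the gamma function for x > 0 only. *)
Definition Gamma (x : R) : R :=
  \int[@lebesgue_measure R]_(t in `]0, +oo[%classic)
    (t `^ (x - 1) * expR (- t)).

(* Meaningful for x > 0, like Gamma. *)
Definition pochhammer (x : R) (n : nat) : R := Gamma (x + n%:R) / Gamma x.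

Definition hypergeometric_term (a b : seq R) (z : R) (n : nat) : R :=
  (\prod_(x <- a) pochhammer x n) / (\prod_(x <- b) pochhammer x n) *
  (z ^+ n / n`!%:R).

(* pFq with p = size a and q = size b *)
Definition hypergeometric (a b : seq R) (z : R) : R :=
  limn (series (hypergeometric_term a b z)).

(* e^(i t) *)
Definition expi (t : R) : R[i] := cos t +i* sin t.

End special_functions.

Section nonlocal_diffusion.
Context {R : realType} (d : nat).
Variables delta alpha : R.

Definition rho (r : R) : R :=
  2 * Gamma (d%:R / 2 + 1) * (d%:R + 2 - alpha) /
  (pi `^ (d%:R / 2) * delta `^ (d%:R + 2 - alpha) * r `^ alpha) *
  \1_(`[0, delta]%classic : set R) r.

Definition symbol_integrand (k : d.-tuple int) (r : vec R d) : R[i] :=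
  (rho (enorm r))%:C * (expi (vdot (vec_of_int k) r) - 1).

Definition lambda (k : d.-tuple int) : R[i] :=
  complex_ball_integral delta (symbol_integrand k).

(* The singularity at the origin is not absolutely integrable when
   d + 1 <= alpha and k <> 0, so lambda's integral may be a principal value. *)
Definition lambda_exists (k : d.-tuple int) : Prop :=
  complex_ball_integral_exists delta (symbol_integrand k).

End nonlocal_diffusion.

(* Main.v *)
From HB Require Import structures.
Require Import Defs.
From mathcomp Require Import all_boot all_order all_algebra.
From mathcomp Require Import complex.
From mathcomp Require Import ring lra.
From mathcomp Require Import all_classical all_reals all_analysis.
From mathcomp Require Import measurable_realfun.

(** The imaginary part of the symbol integrates an odd function over sets
invariant under r |-> -r, so every annulus integral vanishes and with them the
principal value ([Rintegral_odd], [Im_symbol_ball_integral]).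

For the real part, cos (w . r) - 1 is expanded in powers of w . r and the sum is
integrated term by term ([cosine_integral]): on the ball of radius delta all
partial sums are bounded by a constant times (w . r)^2 (see
[norm_sum_cos_coeff]), and |r|^(-alpha) (w . r)^2 is integrable because
alpha < d + 2. What remains is the moment

   int_(|r| <= delta) |r|^(-alpha) (w . r)^(2n) dr,

computed in [integral_radial_moment] without spherical coordinates. Put
f(r) = (w . r)^(2n), which is homogeneous of degree 2n. Scaling gives
int_(|r|^2 <= s) f = V s^p with p = n + d/2, where V is the integral over the
unit ball ([integral_vdot_power_scale]). For any weight of the form
int_(s >= |r|^2) h(s) ds, Tonelli's theorem then gives

   int f(r) (int_(s >= |r|^2) h(s) ds) dr = V int_(s > 0) h(s) s^p ds,

which is [layer_cake_power]. The choice h(s) = exp(-s) yields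
V Gamma(p + 1) = int f(r) exp(-|r|^2) dr, and h(s) = b s^(-b-1) on ]0, delta^2]
with b = alpha/2 yields the moment as V times p/(p - b) delta^(2(p - b)).

The Gaussian integral of f is one-dimensional: under the Gaussian weight, w . r
is distributed as |w| x with x Gaussian on the line ([Gauss_projection], by
induction on the dimension from the planar case [Gauss_planar]). The
one-dimensional even moments are Gamma(n + 1/2) = (2n)! sqrt pi / (4^n n!), which
cancels the factor (2n)! of the cosine series.

Each term of the resulting series is -|w|^2 times a term of the hypergeometric
series, by Gamma(x + 1) = x Gamma(x) ([hypergeometric_termE]). *)

Set Implicit Arguments.
Unset Strict Implicit.
Unset Printing Implicit Defensive.

Import Order.TTheory GRing.Theory Num.Theory.
Import numFieldNormedType.Exports.

Local Open Scope classical_set_scope.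
Local Open Scope ring_scope.
Local Open Scope complex_scope.

Local Notation leb R := (@lebesgue_measure R).

(** * Affine changes of variables *)

(** The image of Lebesgue measure under x |-> a x + b, rescaled by |a|, agrees
with Lebesgue measure on half-open intervals, hence on all Borel sets. *)
Lemma ge0_integral_affine (R : realType) (a b : R) (f : R -> \bar R) :
  a != 0 -> measurable_fun [set: R] f -> (forall x, (0 <= f x)%E) ->
  (\int[leb R]_x f (a * x + b)%R =
   (`|a|^-1)%:E * \int[leb R]_x f x)%E.
Proof.
move=> a0 mf f0.
pose phi : measurableTypeR R -> measurableTypeR R := fun x => a * x + b.
have mphi : measurable_fun setT phi.
  by apply: measurable_funD => //; exact: measurable_funM.
pose k : {nonneg R} := NngNum (normr_ge0 a).
have mE A : measurable A -> leb R A = mscale k (pushforward (leb R) phi) A.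
  apply: lebesgue_measure_unique => //= _ [[u v] _ <-] /=.
  rewrite /mscale/= /pushforward lebesgue_measure_itv/= lte_fin.
  case: (ltrgtP a 0) => [an|ap|/eqP]; last by rewrite (negbTE a0).
  - rewrite (_ : phi @^-1` _ = `[(v - b) / a, (u - b) / a[%classic); last first.
      apply/seteqP; split => x; rewrite /phi/= !in_itv/= ler_ndivrMr// ltr_ndivlMr//;
        by move=> /andP[? ?]; apply/andP; split; lra.
    rewrite lebesgue_measure_itv/= lte_fin ltr_nM2r ?invr_lt0// ltrD2r.
    case: ifPn => _; last by rewrite mule0.
    by rewrite -!EFinD -EFinM ltr0_norm//; congr EFin; field.
  - rewrite (_ : phi @^-1` _ = `](u - b) / a, (v - b) / a]%classic); last first.
      apply/seteqP; split => x; rewrite /phi/= !in_itv/= ler_pdivlMr// ltr_pdivrMr//;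
        by move=> /andP[? ?]; apply/andP; split; lra.
    rewrite lebesgue_measure_itv/= lte_fin ltr_pM2r ?invr_gt0// ltrD2r.
    case: ifPn => _; last by rewrite mule0.
    by rewrite -!EFinD -EFinM gtr0_norm//; congr EFin; field.
have -> : (\int[leb R]_x f x = \int[mscale k (pushforward (leb R) phi)]_x f x)%E.
  by move=> mp; apply: eq_measure_integral => A mA _; exact: mE.
rewrite ge0_integral_mscale// ge0_integral_pushforward//.
by rewrite muleA -EFinM mulVf ?normr_eq0// mul1e preimage_setT.
Qed.

Lemma ge0_integral_scale (R : realType) (a : R) (f : R -> \bar R) :
  a != 0 -> measurable_fun [set: R] f -> (forall x, (0 <= f x)%E) ->
  (\int[leb R]_x f (a * x)%R = (`|a|^-1)%:E * \int[leb R]_x f x)%E.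
Proof.
move=> a0 mf f0; rewrite -(ge0_integral_affine 0 a0 mf f0).
by apply: eq_integral => x _; rewrite addr0.
Qed.

(** The measure on n.+1-tuples is the image under cons of a product measure, so
Tonelli's theorem peels off one coordinate. This is the induction step of every
computation in dimension d. *)
Lemma ge0_integral_vec_cons (R : realType) n (f : vec R n.+1 -> \bar R) :
  measurable_fun setT f -> (forall x, (0 <= f x)%E) ->
  (\int[lebesgue_vec n.+1]_x f x =
   \int[leb R]_x \int[lebesgue_vec n]_t f (vcons (x, t)))%E.
Proof.
move=> mf f0; rewrite /= /lebesgue_vec_cons ge0_integral_pushforward//; last first.
  exact: measurable_vcons.
rewrite preimage_setT fubini_tonelli1//.
  by apply: measurableT_comp => //; exact: measurable_vcons.
by move=> x /=.
Qed.

Definition vscale {R : realType} {n} (c : R) (x : vec R n) : vec R n :=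
  [tuple of map ( *%R c) x].

Lemma vscale_cons (R : realType) n (c x : R) (t : vec R n) :
  vscale c (vcons (x, t)) = vcons (c * x, vscale c t).
Proof. exact/val_inj. Qed.

Lemma measurable_vscale (R : realType) n (c : R) :
  measurable_fun setT (@vscale R n c).
Proof.
apply/measurable_fun_tnthP => i; rewrite (_ : _ \o _ = fun x : vec R n => c * tnth x i).
  by apply: measurable_funM => //; exact: measurable_tnth.
by apply/funext => x /=; rewrite tnth_map.
Qed.

Lemma integral_vec0 (R : realType) (f : vec R 0 -> \bar R) :
  measurable_fun setT f ->
  (\int[lebesgue_vec 0]_x f x = f [tuple])%E.
Proof. by move=> mf; rewrite integral_dirac//= diracE in_setT mul1e. Qed.

Lemma measurable_vcons_tail (R : realType) n (x : R) :
  measurable_fun setT (fun t : vec R n => vcons (x, t)).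
Proof. by apply: measurableT_comp; [exact: measurable_vcons|exact: measurable_pair1]. Qed.

Lemma measurable_integral_vcons (R : realType) n (f : vec R n.+1 -> \bar R) :
  measurable_fun setT f -> (forall x, (0 <= f x)%E) ->
  measurable_fun [set: R] (fun x => \int[lebesgue_vec n]_t f (vcons (x, t)))%E.
Proof.
move=> mf f0; apply: (measurable_fun_fubini_tonelli_F (f \o @vcons R n)).
  by apply: measurableT_comp => //; exact: measurable_vcons.
by move=> x /=.
Qed.

(** With c = -1 this is the invariance under reflection; with c > 0 it turns the
homogeneity of an integrand into a power law for its integrals over balls. *)
Lemma ge0_integral_vscale (R : realType) n (c : R) (f : vec R n -> \bar R) :
  c != 0 -> measurable_fun setT f -> (forall x, (0 <= f x)%E) ->
  (\int[lebesgue_vec n]_x f (vscale c x) =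
   (`|c| ^- n)%:E * \int[lebesgue_vec n]_x f x)%E.
Proof.
move=> c0; elim: n f => [|n IH] f mf f0.
  rewrite !integral_vec0//; last first.
    by apply: measurableT_comp => //; exact: measurable_vscale.
  by rewrite expr0 invr1 mul1e; congr f; apply/val_inj.
have mfs : measurable_fun setT (f \o vscale c).
  by apply: measurableT_comp => //; exact: measurable_vscale.
have mfc x : measurable_fun setT (fun t : vec R n => f (vcons (x, t))).
  by apply: measurableT_comp => //; exact: measurable_vcons_tail.
pose F (x : R) : \bar R := (\int[lebesgue_vec n]_t f (vcons (x, t)))%E.
have mF : measurable_fun [set: R] F by exact: measurable_integral_vcons.
have F0 x : (0 <= F x)%E by apply: integral_ge0.
rewrite !ge0_integral_vec_cons//.
have mFc : measurable_fun [set: measurableTypeR R] (fun x => F (c * x)).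
  by apply: (measurableT_comp mF); exact: measurable_funM.
transitivity (\int[leb R]_x ((`|c| ^- n)%:E * F (c * x)%R))%E.
  apply: eq_integral => x _; under eq_integral do rewrite vscale_cons.
  exact: (IH (fun t => f (vcons (c * x, t)))).
rewrite (ge0_integralZl_EFin _ measurableT _ mFc); last 2 first.
- by move=> x _; exact: F0.
- by rewrite invr_ge0 exprn_ge0.
by rewrite (ge0_integral_scale c0 mF F0) muleA -EFinM exprS invfM mulrC.
Qed.

(** * Layer-cake formula *)

Lemma measurable_sublevel (R : realType) d (T : measurableType d) (N : T -> R)
    (s : R) : measurable_fun setT N -> measurable [set x | N x <= s].
Proof.
move=> mN; rewrite (_ : [set x | _] = N @^-1` `]-oo, s]).
  by rewrite -[X in measurable X]setTI; exact: mN.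
by apply/seteqP; split => x; rewrite /= in_itv.
Qed.

(** Both sides are the integral of f(x) h(s) over the region N(x) <= s, taken in
the two possible orders. *)
Lemma layer_cake (R : realType) d (T : measurableType d)
    (m : {sigma_finite_measure set T -> \bar R}) (N f : T -> R) (h : R -> R) :
  measurable_fun setT N -> measurable_fun setT f -> measurable_fun setT h ->
  (forall x, 0 <= f x) -> (forall s, 0 <= h s) ->
  (\int[m]_x ((f x)%:E * \int[leb R]_(s in `[N x, +oo[) (h s)%:E) =
   \int[leb R]_s ((h s)%:E * \int[m]_(x in [set x | (N x <= s)%R]) (f x)%:E))%E.
Proof.
move=> mN mf mh f0 h0.
pose G (p : T * measurableTypeR R) : \bar R :=
  (if N p.1 <= p.2 then f p.1 * h p.2 else 0)%:E.
have mNs (s : R) : measurable [set x | N x <= s] by exact: measurable_sublevel.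
have mG : measurable_fun setT G.
  apply/measurable_EFinP; apply: measurable_fun_ifT => //.
  - apply: measurable_fun_ler; last exact: measurable_snd.
    by apply: measurableT_comp => //; exact: measurable_fst.
  - apply: measurable_funM.
      by apply: measurableT_comp => //; exact: measurable_fst.
    by apply: measurableT_comp => //; exact: measurable_snd.
have G0 p : (0 <= G p)%E by rewrite lee_fin; case: ifP => // _; rewrite mulr_ge0.
transitivity (\int[m]_x \int[leb R]_s G (x, s))%E.
  apply: eq_integral => x _.
  rewrite -ge0_integralZl_EFin//; last 2 first.
  - by move=> s _; rewrite lee_fin.
  - by apply/measurable_EFinP; exact: measurable_funTS.
  rewrite integral_mkcond; apply: eq_integral => s _.
  rewrite /G/= patchE mem_setE in_itv/= andbT.
  by case: ifP.
rewrite fubini_tonelli//; apply: eq_integral => s _.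
rewrite -ge0_integralZl_EFin//; last 2 first.
- by move=> x _; rewrite lee_fin.
- by apply/measurable_EFinP; exact: measurable_funTS.
rewrite integral_mkcond; apply: eq_integral => x _.
rewrite /G/= patchE.
case: ifPn => [Ns|Ns]; first by rewrite mem_set// mulrC.
by rewrite memNset//=; exact/negP.
Qed.

(** * Integrals of exponentials and powers *)

Lemma integral_expRN_tail (R : realType) (a : R) :
  (\int[leb R]_(s in `[a, +oo[) (expR (- s))%:E = (expR (- a))%:E)%E.
Proof.
rewrite (@ge0_continuous_FTC2y _ _ (fun x => - (expR (- x))) _ 0)//.
- by rewrite EFinN oppeK add0e.
- apply: continuous_subspaceT => x.
  by apply: continuous_comp; [exact: opp_continuous|exact: continuous_expR].
- by rewrite -oppr0; apply: cvgN; exact: cvgr_expR.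
- by apply: cvgN; apply/cvg_at_right_filter; apply: continuous_comp;
    [exact: opp_continuous|exact: continuous_expR].
- move=> x _; rewrite derive1E.
  by rewrite derive_val /GRing.scale/= mulrN1 opprK.
Qed.

Lemma integral_powR_derive (R : realType) (p a b : R) : 0 < a -> a <= b ->
  (\int[leb R]_(s in `[a, b]) (p * s `^ (p - 1))%:E = (b `^ p - a `^ p)%:E)%E.
Proof.
move=> a0; rewrite le_eqVlt => /predU1P[<-|ab].
  by rewrite set_itv1 integral_set1 subrr.
have cpow q x : 0 < x -> {for x, continuous (fun s : R => s `^ q)}.
  move=> x0; apply: differentiable_continuous; apply/derivable1_diffP.
  by apply: derivable_powR; rewrite in_itv/= x0.
rewrite (@continuous_FTC2 _ _ (fun s => s `^ p))//.
- apply: derivable_within_continuous => x; rewrite in_itv/= => /andP[ax _].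
  have x0 := lt_le_trans a0 ax.
  by apply: derivableM => //; apply: derivable_powR; rewrite in_itv/= x0.
- split.
  + move=> x; rewrite in_itv/= => /andP[ax _].
    by apply: derivable_powR; rewrite in_itv/= (lt_trans a0).
  + by apply/cvg_at_right_filter; exact: cpow.
  + by apply/cvg_at_left_filter; apply: cpow; exact: lt_trans ab.
- move=> x; rewrite in_itv/= => /andP[ax _].
  by apply: powR_derive1; rewrite in_itv/= (lt_trans a0).
Qed.

(** For q < 1 the integrand is unbounded at 0, where the fundamental theorem of
calculus does not apply: the integral is the limit of those over
[b / (i + 1), b]. *)
Lemma integral_powR0_derive (R : realType) (q b : R) : 0 < q -> 0 < b ->
  (\int[leb R]_(s in `]0%R, b]) (q * s `^ (q - 1))%:E = (b `^ q)%:E)%E.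
Proof.
move=> q0 b0.
pose F (i : nat) : set (measurableTypeR R) := `[b / i.+1%:R, b]%classic.
have bi i : 0 < b / i.+1%:R by rewrite divr_gt0.
have FE : `]0%R, b]%classic = \bigcup_i F i.
  apply/seteqP; split => x /=; rewrite in_itv/=.
    move=> /andP[x0 xb]; exists (Num.truncn (b / x)) => //.
    rewrite /F/= in_itv/= xb andbT ler_pdivrMr// mulrC -ler_pdivrMr//.
    exact/ltW/truncnS_gt.
  by move=> [i _]; rewrite /F/= in_itv/= => /andP[bx ->]; rewrite andbT (lt_le_trans _ bx).
pose g (s : measurableTypeR R) : \bar R := (q * s `^ (q - 1))%:E.
have mg : measurable_fun setT g.
  by apply/measurable_EFinP; apply: measurable_funM => //; exact: measurable_powR.
have Fnd : nondecreasing_seq F.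
  move=> i j ij; rewrite subsetEset => x; rewrite /F/= !in_itv/= => /andP[bx ->].
  rewrite andbT (le_trans _ bx)// ler_pM2l// lef_pV2 ?posrE// ler_nat//.
have /cvg_lim <- // : (\int[leb R]_(s in F i) g s @[i --> \oo] -->
    \int[leb R]_(s in `]0%R, b]) g s)%E.
  rewrite FE; apply: ge0_nondecreasing_set_cvg_integral => //.
  - by move=> i; exact: measurable_itv.
  - by move=> i; exact: measurable_funTS.
  - by move=> i x _; rewrite lee_fin mulr_ge0 ?powR_ge0// ltW.
apply/cvg_lim => //.
have IFE i : (\int[leb R]_(s in F i) g s = (b `^ q - (b / i.+1%:R) `^ q)%:E)%E.
  rewrite integral_powR_derive// ler_pdivrMr// ler_peMr ?ler1n//.
  exact: ltW.
rewrite (_ : (fun i => _) =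
    EFin \o (fun i : nat => b `^ q - (b / i.+1%:R) `^ q)); last first.
  exact/funext.
apply: cvg_EFin; first exact: nearW.
rewrite -[X in _ --> X]subr0; apply: cvgB; first exact: cvg_cst.
have /cvg_at_rightP := powR_cvg0 q0; apply; split => // .
rewrite -[X in _ --> X](mulr0 b); apply: cvgM; first exact: cvg_cst.
exact: cvg_harmonic.
Qed.

(** * The gamma function *)

(** The extended real of which [Gamma] is the finite part; nonnegative integrals
are manipulated on this side, before finiteness is known. *)
Definition eGamma {R : realType} (x : R) : \bar R :=
  (\int[leb R]_(t in `]0%R, +oo[) (t `^ (x - 1) * expR (- t))%:E)%E.

Lemma measurable_Gamma_integrand (R : realType) (x : R) (D : set R) :
  measurable_fun D (fun t => (t `^ (x - 1) * expR (- t))%:E).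
Proof.
apply: measurable_funTS; apply/measurable_EFinP; apply: measurable_funM.
  exact: measurable_powR.
by apply: measurableT_comp => //; exact: measurable_oppr.
Qed.

Lemma eGamma_ge0 (R : realType) (x : R) : (0 <= eGamma x)%E.
Proof. by apply: integral_ge0 => t _; rewrite lee_fin mulr_ge0 ?powR_ge0 ?expR_ge0. Qed.

(** Layer cake in place of integration by parts: exp(-u) is the integral of
exp(-s) over s >= u, and s^x that of x u^(x-1) over 0 < u <= s. *)
Lemma eGammaD1 (R : realType) (x : R) : 0 < x -> (eGamma (x + 1) = x%:E * eGamma x)%E.
Proof.
move=> x0.
pose f (u : measurableTypeR R) : R := if 0 < u then x * u `^ (x - 1) else 0.
have f0 u : 0 <= f u by rewrite /f; case: ifP => // _; rewrite mulr_ge0 ?powR_ge0// ltW.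
have mf : measurable_fun setT f.
  apply: measurable_fun_ifT => //.
    by apply: measurable_fun_ltr.
  by apply: measurable_funM => //; exact: measurable_powR.
pose h (s : R) : R := expR (- s).
have mh : measurable_fun setT h.
  by apply: measurableT_comp => //; exact: measurable_oppr.
have h0 s : 0 <= h s by exact: expR_ge0.
have := layer_cake (leb R) (@measurable_id _ (measurableTypeR R) setT) mf mh f0 h0.
have -> : (\int[leb R]_u ((f u)%:E * \int[leb R]_(s in `[u, +oo[) (h s)%:E) =
   x%:E * eGamma x)%E.
  rewrite /eGamma -ge0_integralZl_EFin//; last 3 first.
  - by move=> t _; rewrite lee_fin mulr_ge0 ?powR_ge0 ?expR_ge0.
  - exact: measurable_Gamma_integrand.
  - exact: ltW.
  rewrite [RHS]integral_mkcond; apply: eq_integral => u _.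
  rewrite integral_expRN_tail patchE mem_setE in_itv/= andbT /f.
  by case: ifP => _; rewrite ?mul0e// -!EFinM mulrA.
move=> ->.
rewrite /eGamma integral_mkcond; apply: eq_integral => s _.
rewrite patchE mem_setE in_itv/= andbT.
case: ifPn => [s0|s0].
  rewrite addrK EFinM muleC -integral_powR0_derive//; congr (_ * _)%E.
  rewrite integral_mkcond [RHS]integral_mkcond; apply: eq_integral => u _.
  rewrite !patchE [in LHS]mem_setE in_itv/= /f.
  case: (ltP 0 u) => u0 /=; last first.
    by case: ifP.
  have [us|us] := boolP (u <= s); first by rewrite mem_set.
  by rewrite memNset//=; exact/negP.
rewrite integral0_eq ?mule0// => u /= us.
by rewrite /f ltNge (le_trans us)// leNgt.
Qed.

Lemma eGamma1 (R : realType) : eGamma (1 : R) = 1%E.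
Proof.
rewrite /eGamma subrr integral_itv_obnd_cbnd; last first.
  have := @measurable_Gamma_integrand R 1 `]0, +oo[; rewrite subrr.
  by move/measurable_EFinP => h; apply/measurable_EFinP.
under eq_integral do rewrite powRr0 mul1r.
by rewrite integral_expRN_tail oppr0 expR0.
Qed.

Lemma eGammaS (R : realType) (n : nat) : eGamma (n.+1%:R : R) = (n`!%:R)%:E.
Proof.
elim: n => [|n IH]; first exact: eGamma1.
by rewrite -[n.+2%:R]natr1 eGammaD1// IH factS natrM EFinM.
Qed.

(** The recurrence reduces the claim to x + 1, where the integrand is dominated by
the sum of those for two positive integers, whose integrals are factorials. *)
Lemma eGamma_lty (R : realType) (x : R) : 0 < x -> (eGamma x < +oo)%E.
Proof.
move=> x0; suff : (eGamma (x + 1) < +oo)%E.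
  rewrite eGammaD1// => h; rewrite ltNge leye_eq; apply/eqP => e.
  by move: h; rewrite e gt0_muley ?lte_fin// ltxx.
pose n := (Num.truncn x).+1.
have xn : x <= n%:R by apply/ltW/truncnS_gt.
apply: (@le_lt_trans _ _ (eGamma 1 + eGamma n.+1%:R)%E); last first.
  by rewrite eGamma1 eGammaS ltry.
rewrite /eGamma -ge0_integralD//; last 4 first.
- by move=> t _; rewrite lee_fin mulr_ge0 ?powR_ge0 ?expR_ge0.
- exact: measurable_Gamma_integrand.
- by move=> t _; rewrite lee_fin mulr_ge0 ?powR_ge0 ?expR_ge0.
- exact: measurable_Gamma_integrand.
apply: ge0_le_integral => //.
- by move=> t _; rewrite lee_fin mulr_ge0 ?powR_ge0 ?expR_ge0.
- exact: measurable_Gamma_integrand.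
- by apply: emeasurable_funD; exact: measurable_Gamma_integrand.
move=> t; rewrite /= in_itv/= andbT => t0.
rewrite -EFinD lee_fin -mulrDl ler_wpM2r ?expR_ge0// subrr powRr0 addrK.
have [t1|t1] := leP t 1.
  apply: (@le_trans _ _ 1); last by rewrite lerDl powR_ge0.
  by rewrite -(powRr0 t) ger_powR ?t0// ltW.
rewrite -[X in X <= _]add0r lerD// -natr1 addrK ler_powR//.
exact: ltW.
Qed.

Lemma eGammaE (R : realType) (x : R) : 0 < x -> eGamma x = (Gamma x)%:E.
Proof.
move=> x0; rewrite /Gamma /Rintegral fineK// ge0_fin_numE; first exact: eGamma_lty.
exact: eGamma_ge0.
Qed.

Lemma GammaD1 (R : realType) (x : R) : 0 < x -> Gamma (x + 1) = x * Gamma x.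
Proof.
move=> x0; apply: EFin_inj.
by rewrite -eGammaE ?addr_gt0// eGammaD1// EFinM eGammaE.
Qed.

(** By the recurrence it suffices to bound Gamma(x + 1) from below, and there the
integrand is at least exp(-2) on [1, 2]. *)
Lemma Gamma_gt0 (R : realType) (x : R) : 0 < x -> 0 < Gamma x.
Proof.
move=> x0; suff: 0 < Gamma (x + 1) by rewrite GammaD1// pmulr_rgt0.
rewrite -lte_fin -eGammaE ?addr_gt0//.
apply: (@lt_le_trans _ _ (expR (- 2))%:E); first by rewrite lte_fin expR_gt0.
apply: (@le_trans _ _ (\int[leb R]_(t in `[1%R, 2%R]) (expR (- 2))%:E)%E).
  rewrite integral_cst//= lebesgue_measure_itv/= lte_fin ltr1n -EFinD.
  by rewrite -EFinM lee_fin (_ : 2 - 1 = 1) ?mulr1//; lra.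
apply: (@le_trans _ _ (\int[leb R]_(t in `[1%R, 2%R]) (t `^ x * expR (- t))%:E)%E).
  apply: ge0_le_integral => //.
  - by have := @measurable_Gamma_integrand R (x + 1) `[1, 2]; rewrite addrK.
  - move=> t /=; rewrite in_itv/= => /andP[t1 t2]; rewrite lee_fin.
    rewrite -[X in X <= _]mul1r ler_pM ?expR_ge0//.
      by rewrite -(powRr0 t) ler_powR// ltW.
    by rewrite ler_expR lerN2.
rewrite /eGamma addrK; apply: ge0_subset_integral => //.
- by have := @measurable_Gamma_integrand R (x + 1) `]0, +oo[; rewrite addrK.
- by move=> t _; rewrite lee_fin mulr_ge0 ?powR_ge0 ?expR_ge0.
- by move=> t /=; rewrite !in_itv/= andbT => /andP[t1 _]; rewrite (lt_le_trans _ t1).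
Qed.

(** * Weighted integrals under a power law for sublevel integrals *)

Section power_growth.
Context (R : realType) d (T : measurableType d).
Variables (m : {sigma_finite_measure set T -> \bar R}) (N f : T -> R).
Variables (p : R) (V : \bar R).
Hypotheses (mN : measurable_fun setT N) (mf : measurable_fun setT f).
Hypotheses (N0 : forall x, 0 <= N x) (f0 : forall x, 0 <= f x).
Hypothesis V0 : (0 <= V)%E.
Hypothesis growth : forall s : R, 0 < s ->
  (\int[m]_(x in [set x | (N x <= s)%R]) (f x)%:E = (s `^ p)%:E * V)%E.

(** The layer-cake formula with the power law substituted for s > 0; the sublevel
sets of N are empty for s < 0, and s = 0 is a null set. *)
Lemma layer_cake_power (h : R -> R) :
  measurable_fun setT h -> (forall s, 0 <= h s) ->
  (\int[m]_x ((f x)%:E * \int[leb R]_(s in `[N x, +oo[) (h s)%:E) =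
   V * \int[leb R]_(s in `]0%R, +oo[) (h s * s `^ p)%:E)%E.
Proof.
move=> mh h0; rewrite layer_cake//.
have mpow (D : set (measurableTypeR R)) : measurable_fun D (fun s => (h s * s `^ p)%:E).
  apply: measurable_funTS; apply/measurable_EFinP.
  by apply: measurable_funM; [exact: mh|exact: measurable_powR].
pose G (s : measurableTypeR R) : \bar R :=
  ((h s)%:E * \int[m]_(x in [set x | (N x <= s)%R]) (f x)%:E)%E.
have GE (s : R) : s \in `]0, +oo[%classic -> G s = (V * (h s * s `^ p)%:E)%E.
  by rewrite inE/= in_itv/= andbT => s0; rewrite /G growth// muleA -EFinM muleC.
transitivity (\int[leb R]_(s in `[0%R, +oo[) G s)%E.
  rewrite [RHS]integral_mkcond; apply: eq_integral => s _.
  rewrite patchE mem_setE in_itv/= andbT; case: ifPn => // s0.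
  rewrite [X in (_ * X)%E](_ : _ = 0%E) ?mule0//.
  rewrite (_ : [set x | _] = set0) ?integral_set0//.
  by apply/seteqP; split => // x /= Nxs; move/negP: s0; apply; exact: le_trans Nxs.
rewrite -integral_itv_obnd_cbnd; last first.
  apply: (eq_measurable_fun (fun s => V * (h s * s `^ p)%:E)%E).
    by move=> s /GE.
  by apply: measurable_funeM; exact: mpow.
rewrite -ge0_integralZl//.
- by apply: eq_integral => s /GE.
- by move=> s _; rewrite lee_fin mulr_ge0 ?powR_ge0.
Qed.

Lemma integral_expRN_power :
  (\int[m]_x (f x * expR (- N x))%:E = V * eGamma (p + 1))%E.
Proof.
rewrite /eGamma addrK.
under [in RHS]eq_integral do rewrite mulrC.
rewrite -(@layer_cake_power (fun s => expR (- s))).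
- by apply: eq_integral => x _; rewrite integral_expRN_tail.
- by apply: measurableT_comp => //; exact: measurable_oppr.
- by move=> s; exact: expR_ge0.
Qed.

(** N^(-b) on the sublevel set N <= D is a layer-cake weight up to a constant: for
0 < N <= D, the integral of b s^(-b-1) over [N, D] is N^(-b) - D^(-b). Where N
vanishes this identity fails, whence the hypothesis that f vanishes there. *)
Lemma integral_powRN_power (b D : R) : (forall x, N x = 0 -> f x = 0) ->
  0 <= b -> b < p -> 0 < D ->
  (\int[m]_(x in [set x | (N x <= D)%R]) (f x * N x `^ (- b))%:E =
   V * (p / (p - b) * D `^ (p - b))%:E)%E.
Proof.
move=> fN0 b0 bp D0.
have pb : 0 < p - b by rewrite subr_gt0.
pose h (s : R) : R := if (0 < s <= D) then b * s `^ (- b - 1) else 0.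
have h0 s : 0 <= h s by rewrite /h; case: ifP => // _; rewrite mulr_ge0// powR_ge0.
have mh : measurable_fun setT h.
  apply: measurable_fun_ifT => //.
    by apply: measurable_and; [exact: measurable_fun_ltr|exact: measurable_fun_ler].
  by apply: measurable_funM => //; exact: measurable_powR.
have := layer_cake_power mh h0.
have -> : (\int[leb R]_(s in `]0%R, +oo[) (h s * s `^ p)%:E =
    (b / (p - b) * D `^ (p - b))%:E)%E.
  rewrite EFinM -integral_powR0_derive// -ge0_integralZl_EFin//.
  - rewrite [LHS]integral_mkcond [RHS]integral_mkcond.
    apply: eq_integral => s _.
    rewrite !patchE !mem_setE !in_itv/= andbT /h.
    case: (ltP 0 s) => //= s0; case: ifPn => sD; last by rewrite mul0r.
    rewrite -EFinM mulrA divfK ?gt_eqF//; congr EFin.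
    rewrite -mulrA -powRD; last by rewrite (gt_eqF s0) implybT.
    by congr (_ * _ `^ _); ring.
  - by move=> s _; rewrite lee_fin mulr_ge0 ?powR_ge0// ltW.
  - apply: measurable_funTS; apply/measurable_EFinP.
    by apply: measurable_funM => //; exact: measurable_powR.
  - by rewrite divr_ge0// ltW.
have hE x : N x <= D -> 0 < N x ->
    (\int[leb R]_(s in `[N x, +oo[) (h s)%:E = (N x `^ (- b) - D `^ (- b))%:E)%E.
  move=> ND Nx0.
  have := integral_powR_derive (- b) Nx0 ND.
  under eq_integral do rewrite mulNr EFinN.
  rewrite integral_ge0N; last first.
    by move=> s _; rewrite lee_fin mulr_ge0 ?powR_ge0.
  move=> /(congr1 oppe); rewrite oppeK -EFinN opprB => <-.
  rewrite [LHS]integral_mkcond [RHS]integral_mkcond; apply: eq_integral => s _.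
  rewrite !patchE !mem_setE !in_itv/= andbT /h.
  by case: (leP (N x) s) => //= sN; rewrite (lt_le_trans Nx0 sN)/=; case: ifP.
have hE0 x : D < N x -> (\int[leb R]_(s in `[N x, +oo[) (h s)%:E = 0)%E.
  move=> DN; apply: integral0_eq => s /=; rewrite in_itv/= andbT /h => Ns.
  by rewrite [s <= D]leNgt (lt_le_trans DN Ns) andbF.
(* The product of f and the weight, written without an integral: this form is
   visibly real-valued and measurable. *)
pose k (x : T) : R := if N x <= D then f x * (N x `^ (- b) - D `^ (- b)) else 0.
have kE x : ((f x)%:E * \int[leb R]_(s in `[N x, +oo[) (h s)%:E = (k x)%:E)%E.
  rewrite /k; case: ifPn => [ND|]; last by rewrite -ltNge => /hE0 ->; rewrite mule0.
  have := N0 x; rewrite le_eqVlt => /predU1P[/esym/fN0 ->|Nx0]; last by rewrite hE// -EFinM.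
  by rewrite mul0e mul0r.
have k0 x : 0 <= k x.
  rewrite -lee_fin -kE mule_ge0 ?lee_fin//.
  by apply: integral_ge0 => s _; rewrite lee_fin.
have mNb : measurable_fun setT (fun x => N x `^ (- b)).
  exact: (measurableT_comp (@measurable_powR R (- b)) mN).
have mk : measurable_fun setT k.
  apply: measurable_fun_ifT => //; first exact: measurable_fun_ler.
  by apply: measurable_funM => //; exact: measurable_funB.
under eq_integral do rewrite kE.
move=> lc; have mND := measurable_sublevel D mN.
transitivity (\int[m]_(x in [set x | (N x <= D)%R])
    ((k x)%:E + (D `^ (- b))%:E * (f x)%:E))%E.
  by apply: eq_integral => x; rewrite inE/= /k => ->; rewrite -EFinM -EFinD; congr EFin; ring.
rewrite ge0_integralD//; last 4 first.
- by move=> x _; rewrite lee_fin.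
- by apply: measurable_funTS; exact/measurable_EFinP.
- by move=> x _; rewrite mule_ge0 ?lee_fin// powR_ge0.
- by apply: measurable_funTS; apply: measurable_funeM; exact/measurable_EFinP.
rewrite ge0_integralZl_EFin ?powR_ge0//; last 2 first.
- by move=> x _; rewrite lee_fin.
- by apply: measurable_funTS; exact/measurable_EFinP.
rewrite growth// (_ : \int[m]_(x in _) (k x)%:E = \int[m]_x (k x)%:E)%E; last first.
  rewrite integral_mkcond; apply: eq_integral => x _; rewrite patchE /k.
  by case: ifPn => // /negP; rewrite inE/= => /negP/negbTE ->.
rewrite lc muleA -EFinM -powRD; last by rewrite (gt_eqF D0) implybT.
rewrite [X in (_ + X)%E]muleC -ge0_muleDr//; last 2 first.
- by rewrite lee_fin mulr_ge0 ?powR_ge0// divr_ge0// ltW.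
- by rewrite lee_fin powR_ge0.
congr (V * _)%E; rewrite -EFinD [- b + p]addrC; congr EFin.
by rewrite -[X in _ + X]mul1r -mulrDl; congr (_ * _); field; rewrite gt_eqF.
Qed.

End power_growth.

(** * Gaussian moments on the line *)

Lemma integral_even_power (R : realType) (n : nat) (s : R) : 0 < s ->
  (\int[leb R]_(x in [set x | (x ^+ 2 <= s)%R]) (x ^+ n.*2)%:E =
   (s `^ (n%:R + 2^-1))%:E * (n%:R + 2^-1)^-1%:E)%E.
Proof.
move=> s0; set r := Num.sqrt s.
have r0 : 0 < r by rewrite sqrtr_gt0.
have -> : [set x : R | x ^+ 2 <= s] = `[- r, r]%classic.
  apply/seteqP; split => x /=; rewrite in_itv/= -ler_norml.
    by move=> xs; rewrite -sqrtr_sqr ler_sqrt// ltW.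
  move=> xr; rewrite -(sqr_sqrtr (ltW s0)) -(real_normK (num_real x)).
  by rewrite ler_pXn2r// ?nnegrE// ltW.
have n2 : (n.*2.+1)%:R != 0 :> R by rewrite pnatr_eq0.
pose F (x : R) : R := n.*2.+1%:R^-1 * x ^+ n.*2.+1.
have dF (x : R) : is_derive x 1 F (x ^+ n.*2).
  have -> : F = n.*2.+1%:R^-1 \*: (id ^+ n.*2.+1 : R -> R).
    by apply/funext => y; rewrite /F/= fctE.
  by apply: is_derive_eq; rewrite /GRing.scale/= mulr1 mulrA mulVf// mul1r.
have cF (x : R) : {for x, continuous F}.
  by apply: differentiable_continuous; apply/derivable1_diffP; exact: ex_derive.
rewrite (@continuous_FTC2 _ _ F).
- rewrite -EFinB -EFinM; congr EFin.
  rewrite /F exprNn -signr_odd/= odd_double expr1 mulN1r mulrN opprK -mulrDl.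
  rewrite -powR_mulrn ?ltW// /r -powR12_sqrt ?ltW// -powRrM mulrC.
  have -> : n.*2.+1%:R = 2 * (n%:R + 2^-1) :> R.
    by rewrite -natr1 -muln2 natrM; field.
  rewrite mulKf//; congr (_ * _); field.
  by rewrite gt_eqF// ltr_wpDl.
- by rewrite gtrN.
- by apply: continuous_subspaceT => x; exact: exprn_continuous.
- split.
  + by move=> x _; apply: ex_derive.
  + by apply/cvg_at_right_filter; exact: cF.
  + by apply/cvg_at_left_filter; exact: cF.
- by move=> x _; rewrite derive1E derive_val.
Qed.

(** The layer-cake formula with N(x) = x^2: the integral of x^(2n) over x^2 <= s is
s^(n + 1/2) / (n + 1/2), and this denominator is absorbed by
Gamma(n + 3/2) = (n + 1/2) Gamma(n + 1/2). *)
Lemma Gauss_even_moment (R : realType) (n : nat) :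
  (\int[leb R]_x (x ^+ n.*2 * expR (- x ^+ 2))%:E = (Gamma (n%:R + 2^-1))%:E)%E.
Proof.
have n0 : 0 < n%:R + 2^-1 :> R by rewrite ltr_wpDl.
rewrite (@integral_expRN_power _ _ _ (leb R) (fun x => x ^+ 2) (fun x => x ^+ n.*2)
  (n%:R + 2^-1) (n%:R + 2^-1)^-1%:E).
- by rewrite eGammaD1// muleA -EFinM mulVf ?gt_eqF// mul1e eGammaE.
- exact: exprn_measurable.
- exact: exprn_measurable.
- by move=> x; exact: sqr_ge0.
- by move=> x; rewrite -mul2n exprM exprn_ge0// sqr_ge0.
- by rewrite lee_fin invr_ge0 ltW.
- exact: integral_even_power.
Qed.

Lemma Gamma_half (R : realType) : Gamma (2^-1 : R) = Num.sqrt pi.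
Proof.
apply: EFin_inj; rewrite -integralT_gauss.
have := Gauss_even_moment R 0; rewrite add0r => <-.
by apply: eq_integral => x _; rewrite expr0 mul1r.
Qed.

Lemma Gamma_nat_half (R : realType) (n : nat) :
  Gamma (n%:R + 2^-1 : R) = (n.*2)`!%:R / (4 ^+ n * n`!%:R) * Num.sqrt pi.
Proof.
elim: n => [|n IH]; first by rewrite add0r Gamma_half expr0 mulr1 divr1 mul1r.
rewrite -natr1 addrAC GammaD1 ?ltr_wpDl// IH doubleS !factS !natrM exprS.
have n1 : n.+1%:R != 0 :> R by rewrite pnatr_eq0.
have nf : n`!%:R != 0 :> R by rewrite pnatr_eq0 -lt0n fact_gt0.
have p4 : 4 ^+ n != 0 :> R by rewrite expf_neq0.
have -> : n.*2.+2%:R = n.+1%:R * 2 :> R by rewrite -doubleS -[in LHS]muln2 natrM.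
have -> : n.*2.+1%:R = n%:R * 2 + 1 :> R by rewrite -muln2 -natr1 natrM.
by field; rewrite p4 nf/= ?nat1r ?natr1 n1.
Qed.

(** * Projection of a Gaussian onto a line *)

Lemma ge0_integralZl_EFinM d (T : measurableType d) (R : realType)
    (m : {measure set T -> \bar R}) (k : R) (f : T -> R) :
  0 <= k -> measurable_fun setT f -> (forall x, 0 <= f x) ->
  (\int[m]_x (k * f x)%:E = k%:E * \int[m]_x (f x)%:E)%E.
Proof.
move=> k0 mf f0; rewrite -ge0_integralZl_EFin//.
- by move=> x _; rewrite lee_fin.
- exact/measurable_EFinP.
Qed.

Section planar_gauss.
Context {R : realType}.
Implicit Types (x y u a b c : measurableTypeR R) (phi : measurableTypeR R -> R).

Lemma measurable_gauss : measurable_fun setT (gauss_fun : measurableTypeR R -> R).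
Proof. exact: measurable_gauss_fun. Qed.

Lemma Gauss_scale (c : R) phi :
  c != 0 -> measurable_fun setT phi -> (forall u, 0 <= phi u) ->
  (\int[leb R]_x (gauss_fun x * phi (c * x))%:E =
   (`|c|^-1)%:E * \int[leb R]_u (gauss_fun (u / c) * phi u)%:E)%E.
Proof.
move=> c0 mphi phi0.
pose g u : \bar R := (gauss_fun (u / c) * phi u)%:E.
have g0 u : (0 <= g u)%E by rewrite lee_fin mulr_ge0// gauss_fun_ge0.
have mg : measurable_fun setT g.
  apply/measurable_EFinP; apply: measurable_funM => //.
  apply: (measurableT_comp measurable_gauss); exact: measurable_funM.
rewrite -(ge0_integral_scale c0 mg g0).
by apply: eq_integral => x _; rewrite /g mulrAC mulfV// mul1r.
Qed.

Lemma Gauss_affine (a b : R) phi :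
  b != 0 -> measurable_fun setT phi -> (forall u, 0 <= phi u) ->
  (\int[leb R]_y (gauss_fun y * phi (a + b * y))%:E =
   (`|b|^-1)%:E * \int[leb R]_u (gauss_fun ((u - a) / b) * phi u)%:E)%E.
Proof.
move=> b0 mphi phi0.
pose g u : \bar R := (gauss_fun ((u - a) / b) * phi u)%:E.
have g0 u : (0 <= g u)%E by rewrite lee_fin mulr_ge0// gauss_fun_ge0.
have mg : measurable_fun setT g.
  apply/measurable_EFinP; apply: measurable_funM => //.
  apply: (measurableT_comp measurable_gauss); apply: measurable_funM => //.
  exact: measurable_funB.
rewrite -(ge0_integral_affine a b0 mg g0).
apply: eq_integral => y _; rewrite /g addrK [b * y]mulrC mulfK//.
by rewrite addrC [y * b]mulrC.
Qed.

Lemma integral_gauss_fun_affine (a b : R) : b != 0 ->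
  (\int[leb R]_x (gauss_fun (b * x + a)%R)%:E = (Num.sqrt pi / `|b|)%:E)%E.
Proof.
move=> b0; rewrite (@ge0_integral_affine R b a (EFin \o gauss_fun))//; last 2 first.
- by apply/measurable_EFinP; exact: measurable_gauss.
- by move=> x /=; rewrite lee_fin gauss_fun_ge0.
by rewrite integralT_gauss -EFinM mulrC.
Qed.

Lemma complete_square (F : fieldType) (a b c x u : F) :
  b != 0 -> c != 0 -> c ^+ 2 = a ^+ 2 + b ^+ 2 ->
  - x ^+ 2 - ((u - a * x) / b) ^+ 2 =
  - (u / c) ^+ 2 - (c / b * x - a * u / (b * c)) ^+ 2.
Proof.
move=> b0 c0 c2; apply/eqP; rewrite -subr_eq0; apply/eqP.
transitivity ((c ^+ 2 - (a ^+ 2 + b ^+ 2)) *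
    (x ^+ 2 / b ^+ 2 - u ^+ 2 / (b ^+ 2 * c ^+ 2))).
  by field; rewrite b0 c0.
by rewrite c2 subrr mul0r.
Qed.

(** Distribution of a x + b y for independent Gaussian x and y. If b != 0, the
variable y is traded for u = a x + b y; completing the square with
c^2 = a^2 + b^2 separates u from x, and the integral over x is again Gaussian. *)
Lemma Gauss_planar (a b : R) phi :
  measurable_fun setT phi -> (forall u, 0 <= phi u) ->
  (\int[leb R]_x \int[leb R]_y (gauss_fun x * (gauss_fun y * phi (a * x + b * y)))%:E =
   (Num.sqrt pi)%:E *
   \int[leb R]_x (gauss_fun x * phi (Num.sqrt (a ^+ 2 + b ^+ 2) * x))%:E)%E.
Proof.
move=> mphi phi0.
have mg1 := measurable_gauss.
have mphic (c : R) : measurable_fun [set: measurableTypeR R] (fun x => phi (c * x)).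
  by apply: (measurableT_comp mphi); exact: measurable_funM.
have [->|b0] := eqVneq b 0.
  rewrite expr0n addr0 sqrtr_sqr.
  transitivity (\int[leb R]_x ((Num.sqrt pi) * (gauss_fun x * phi (a * x)))%:E)%E.
    apply: eq_integral => x _.
    transitivity (\int[leb R]_y ((gauss_fun x * phi (a * x)) * gauss_fun y)%:E)%E.
      by apply: eq_integral => y _; rewrite mul0r addr0 mulrA mulrAC.
    rewrite ge0_integralZl_EFinM ?mulr_ge0 ?gauss_fun_ge0//.
    + by rewrite integralT_gauss -EFinM mulrC.
    + exact: gauss_fun_ge0.
  rewrite ge0_integralZl_EFinM ?sqrtr_ge0//; last 2 first.
  - exact: measurable_funM.
  - by move=> x; rewrite mulr_ge0 ?gauss_fun_ge0.
  congr (_ * _)%E.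
  have [a0|a0] := leP 0 a; first by rewrite ger0_norm.
  have -> : `|a| = - a by rewrite ltr0_norm.
  pose g x : \bar R := (gauss_fun x * phi (a * x))%:E.
  have g0 x : (0 <= g x)%E by rewrite lee_fin mulr_ge0 ?gauss_fun_ge0.
  have mg : measurable_fun setT g by apply/measurable_EFinP; exact: measurable_funM.
  have N1 : -1 != 0 :> R by rewrite oppr_eq0 oner_eq0.
  have := ge0_integral_scale N1 mg g0; rewrite normrN1 invr1 mul1e => <-.
  by apply: eq_integral => x _; rewrite /g /gauss_fun mulN1r sqrrN mulrN mulNr.
set c := Num.sqrt (a ^+ 2 + b ^+ 2).
have c2 : c ^+ 2 = a ^+ 2 + b ^+ 2 by rewrite sqr_sqrtr// addr_ge0// sqr_ge0.
have c0 : 0 < c by rewrite sqrtr_gt0 ltr_wpDl ?sqr_ge0// exprn_even_gt0.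
pose K x u : R := gauss_fun x * (gauss_fun ((u - a * x) / b) * phi u).
have K0 x u : 0 <= K x u by rewrite !mulr_ge0 ?gauss_fun_ge0.
pose K' (p : measurableTypeR R * measurableTypeR R) : \bar R := (K p.1 p.2)%:E.
have mK : measurable_fun setT K'.
  apply/measurable_EFinP; apply: measurable_funM.
    by apply: (measurableT_comp measurable_gauss); exact: measurable_fst.
  apply: measurable_funM; last by apply: measurableT_comp => //; exact: measurable_snd.
  apply: (measurableT_comp measurable_gauss); apply: measurable_funM => //.
  apply: measurable_funB; first exact: measurable_snd.
  by apply: measurable_funM => //; exact: measurable_fst.
have KE x u : K x u =
    gauss_fun (u / c) * phi u * gauss_fun (c / b * x + (- (a * u / (b * c)))).
  rewrite /K [in RHS]mulrAC mulrA; congr (_ * _); rewrite -!expRD; congr expR.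
  have cN0 : c != 0 by rewrite gt_eqF.
  by apply: complete_square.
transitivity (\int[leb R]_x ((`|b|^-1)%:E * \int[leb R]_u (K x u)%:E))%E.
  apply: eq_integral => x _.
  rewrite ge0_integralZl_EFinM ?gauss_fun_ge0//; last 2 first.
  - apply: measurable_funM => //; apply: (measurableT_comp mphi).
    by apply: measurable_funD => //; exact: measurable_funM.
  - by move=> y; rewrite mulr_ge0 ?gauss_fun_ge0.
  rewrite Gauss_affine// ge0_integralZl_EFinM ?gauss_fun_ge0//; last 2 first.
  - apply: measurable_funM => //; apply: (measurableT_comp mg1).
    by apply: measurable_funM => //; exact: measurable_funB.
  - by move=> y; rewrite mulr_ge0 ?gauss_fun_ge0.
  by rewrite muleCA.
rewrite ge0_integralZl_EFin ?invr_ge0//; last 2 first.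
- by move=> x _; apply: integral_ge0 => u _; rewrite lee_fin.
- apply: (measurable_fun_fubini_tonelli_F K' mK).
  by move=> p; rewrite lee_fin.
rewrite (fubini_tonelli K')//=; last by move=> p; rewrite lee_fin.
transitivity ((`|b|^-1)%:E *
    \int[leb R]_u ((Num.sqrt pi / `|c / b|) * (gauss_fun (u / c) * phi u))%:E)%E.
  congr (_ * _)%E; apply: eq_integral => u _; rewrite /K'/=.
  under eq_integral do rewrite KE.
  rewrite ge0_integralZl_EFinM//; last 3 first.
  - by rewrite mulr_ge0 ?gauss_fun_ge0.
  - by apply: (measurableT_comp mg1); apply: measurable_funD => //; exact: measurable_funM.
  - by move=> x; exact: gauss_fun_ge0.
  by rewrite integral_gauss_fun_affine ?mulf_neq0 ?invr_eq0 ?(gt_eqF c0)// -EFinM mulrC.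
rewrite Gauss_scale ?gt_eqF// ge0_integralZl_EFinM//; last 2 first.
- apply: measurable_funM => //; apply: (measurableT_comp mg1).
  exact: measurable_funM.
- by move=> u; rewrite mulr_ge0 ?gauss_fun_ge0.
rewrite !muleA -!EFinM; congr (_%:E * _)%E.
rewrite normrM normfV; field.
by rewrite !normr_eq0 b0 gt_eqF.
Qed.

End planar_gauss.

Section vec_gauss.
Context {R : realType}.

Definition enorm2 {n} (x : vec R n) : R := \sum_(i < n) (tnth x i : R) ^+ 2.

Lemma enorm2_ge0 n (x : vec R n) : 0 <= enorm2 x.
Proof. by apply: sumr_ge0 => i _; exact: sqr_ge0. Qed.

Lemma sqr_enorm n (x : vec R n) : enorm x ^+ 2 = enorm2 x.
Proof. by rewrite sqr_sqrtr// enorm2_ge0. Qed.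

Lemma enorm2_vcons n (a : R) (t : vec R n) : enorm2 (vcons (a, t)) = a ^+ 2 + enorm2 t.
Proof.
rewrite /enorm2 big_ord_recl tnth0; congr (_ + _).
by apply: eq_bigr => i _; rewrite tnthS.
Qed.

Lemma vdot_vcons n (a b : R) (w t : vec R n) :
  vdot (vcons (a, w)) (vcons (b, t)) = a * b + vdot w t.
Proof.
rewrite /vdot big_ord_recl !tnth0; congr (_ + _).
by apply: eq_bigr => i _; rewrite !tnthS.
Qed.

Lemma measurable_enorm2 n : measurable_fun setT (@enorm2 n).
Proof.
apply: measurable_sum => i; apply: measurable_funX; exact: measurable_tnth.
Qed.

Lemma measurable_expRN_enorm2 n : measurable_fun setT (fun r : vec R n => expR (- enorm2 r)).
Proof.
by apply: measurableT_comp => //; apply: measurableT_comp => //; exact: measurable_enorm2.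
Qed.

Lemma measurable_vdot n (w : vec R n) : measurable_fun setT (vdot w).
Proof.
apply: measurable_sum => i; apply: measurable_funM => //; exact: measurable_tnth.
Qed.

Lemma vec_consP n (w : vec R n.+1) : exists a (w' : vec R n), w = vcons (a, w').
Proof. by case/tupleP: w => a w'; exists a, w'; apply/val_inj. Qed.

Lemma enorm2_vscale n (c : R) (x : vec R n) : enorm2 (vscale c x) = c ^+ 2 * enorm2 x.
Proof.
by rewrite /enorm2 mulr_sumr; apply: eq_bigr => i _; rewrite tnth_map exprMn.
Qed.

Lemma vdot_vscale n (c : R) (w x : vec R n) : vdot w (vscale c x) = c * vdot w x.
Proof.
by rewrite /vdot mulr_sumr; apply: eq_bigr => i _; rewrite tnth_map mulrCA.
Qed.

(** The factor sqrt pi on the left makes the statement uniform in n, including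
n = 0 where no Gaussian factor is available. *)
Lemma Gauss_projection n (w : vec R n) (phi : measurableTypeR R -> R) :
  measurable_fun setT phi -> (forall u, 0 <= phi u) ->
  ((Num.sqrt pi)%:E * \int[lebesgue_vec n]_r (expR (- enorm2 r) * phi (vdot w r))%:E =
   (Num.sqrt pi ^+ n)%:E * \int[leb R]_x (gauss_fun x * phi (enorm w * x))%:E)%E.
Proof.
elim: n w phi => [|n IH] w phi mphi phi0.
  rewrite integral_vec0; last first.
    apply/measurable_EFinP; apply: measurable_funM.
      apply: measurableT_comp => //.
      by apply: measurableT_comp => //; exact: measurable_enorm2.
    by apply: (measurableT_comp mphi); exact: measurable_vdot.
  rewrite /enorm2 /vdot /enorm !big_ord0 oppr0 expR0 mul1r sqrtr0 expr0 mul1e.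
  under eq_integral do rewrite mul0r mulrC.
  rewrite ge0_integralZl_EFinM//; last 2 first.
  - exact: measurable_gauss.
  - exact: gauss_fun_ge0.
  by rewrite integralT_gauss muleC.
have [a [w' ->]] := vec_consP w.
pose g (r : vec R n.+1) : \bar R := (expR (- enorm2 r) * phi (vdot (vcons (a, w')) r))%:E.
have g0 r : (0 <= g r)%E by rewrite lee_fin mulr_ge0 ?expR_ge0.
have mg : measurable_fun setT g.
  apply/measurable_EFinP; apply: measurable_funM.
    apply: measurableT_comp => //.
    by apply: measurableT_comp => //; exact: measurable_enorm2.
  by apply: (measurableT_comp mphi); exact: measurable_vdot.
rewrite (ge0_integral_vec_cons mg g0) -ge0_integralZl_EFin ?sqrtr_ge0//; last 2 first.
- by move=> x _; exact: integral_ge0.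
- exact: measurable_integral_vcons.
transitivity (\int[leb R]_x ((Num.sqrt pi ^+ n)%:E *
    \int[leb R]_y (gauss_fun x * (gauss_fun y * phi (a * x + enorm w' * y)))%:E))%E.
  apply: eq_integral => x _.
  rewrite [in RHS]ge0_integralZl_EFinM ?gauss_fun_ge0//; last 2 first.
  - apply: measurable_funM; first exact: measurable_gauss.
    by apply: (measurableT_comp mphi); apply: measurable_funD => //; exact: measurable_funM.
  - by move=> y; rewrite mulr_ge0 ?gauss_fun_ge0.
  rewrite [in RHS]muleCA -(IH w' (fun u => phi (a * x + u))) => //; last first.
    by apply: (measurableT_comp mphi); exact: measurable_funD.
  rewrite [in RHS]muleCA; congr (_ * _)%E.
  rewrite -[RHS]ge0_integralZl_EFinM ?gauss_fun_ge0//; last 2 first.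
  - apply: measurable_funM; first exact: measurable_expRN_enorm2.
    apply: (measurableT_comp mphi); apply: measurable_funD => //.
    exact: measurable_vdot.
  - by move=> t; rewrite mulr_ge0 ?expR_ge0.
  apply: eq_integral => t _.
  by rewrite /g enorm2_vcons vdot_vcons opprD expRD mulrA.
pose K (p : measurableTypeR R * measurableTypeR R) : \bar R :=
  (gauss_fun p.1 * (gauss_fun p.2 * phi (a * p.1 + enorm w' * p.2)))%:E.
have mK : measurable_fun setT K.
  apply/measurable_EFinP; apply: measurable_funM.
    by apply: (measurableT_comp measurable_gauss); exact: measurable_fst.
  apply: measurable_funM.
    by apply: (measurableT_comp measurable_gauss); exact: measurable_snd.
  apply: (measurableT_comp mphi); apply: measurable_funD.
    by apply: measurable_funM => //; exact: measurable_fst.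
  by apply: measurable_funM => //; exact: measurable_snd.
have K0 p : (0 <= K p)%E by rewrite lee_fin !mulr_ge0 ?gauss_fun_ge0.
rewrite ge0_integralZl_EFin ?exprn_ge0 ?sqrtr_ge0//; last 2 first.
- by move=> x _; apply: integral_ge0 => y _; exact: (K0 (x, y)).
- exact: (measurable_fun_fubini_tonelli_F K mK).
rewrite Gauss_planar// muleA -EFinM -exprSr.
by rewrite sqr_enorm -enorm2_vcons.
Qed.

End vec_gauss.

(** * Moments over balls *)

Section radial_moment.
Context {R : realType} (d : nat).
Implicit Types w r : vec R d.

Lemma measurable_vdot_power w (m : nat) : measurable_fun setT (fun r => vdot w r ^+ m).
Proof. by apply: measurable_funX; exact: measurable_vdot. Qed.

Lemma even_power_ge0 (n : nat) (x : R) : 0 <= x ^+ n.*2.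
Proof. by rewrite -mul2n exprM exprn_ge0// sqr_ge0. Qed.

(** Substitute r = sqrt s r': the volume contributes (sqrt s)^d and the homogeneous
integrand s^n. *)
Lemma integral_vdot_power_scale w (n : nat) (s : R) : 0 < s ->
  (\int[lebesgue_vec d]_(r in [set r | (enorm2 r <= s)%R]) (vdot w r ^+ n.*2)%:E =
   (s `^ (n%:R + d%:R / 2))%:E *
   \int[lebesgue_vec d]_(r in [set r | (enorm2 r <= 1)%R]) (vdot w r ^+ n.*2)%:E)%E.
Proof.
move=> s0; set c := Num.sqrt s.
have c0 : 0 < c by rewrite sqrtr_gt0.
have c2 : c ^+ 2 = s by rewrite sqr_sqrtr// ltW.
pose G (t : R) r : \bar R := (if enorm2 r <= t then vdot w r ^+ n.*2 else 0)%:E.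
have GE t : (\int[lebesgue_vec d]_(r in [set r | (enorm2 r <= t)%R]) (vdot w r ^+ n.*2)%:E =
    \int[lebesgue_vec d]_r G t r)%E.
  rewrite integral_mkcond; apply: eq_integral => r _; rewrite patchE /G.
  have [rt|rt] := boolP (enorm2 r <= t); first by rewrite mem_set.
  by rewrite memNset//=; exact/negP.
have G0 t r : (0 <= G t r)%E.
  by rewrite lee_fin; case: ifP => // _; exact: even_power_ge0.
have mG t : measurable_fun setT (G t).
  apply/measurable_EFinP; apply: measurable_fun_ifT => //.
    by apply: measurable_fun_ler => //; exact: measurable_enorm2.
  exact: measurable_vdot_power.
rewrite !GE.
have := ge0_integral_vscale (lt0r_neq0 c0) (mG s) (G0 s).
have -> : (\int[lebesgue_vec d]_r G s (vscale c r) =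
    (s ^+ n)%:E * \int[lebesgue_vec d]_r G 1%R r)%E.
  rewrite -ge0_integralZl_EFin ?exprn_ge0 ?ltW//.
  apply: eq_integral => r _; rewrite /G enorm2_vscale c2 -EFinM; congr EFin.
  rewrite -[X in _ <= X]mulr1 ler_pM2l//; case: ifPn => _; last by rewrite mulr0.
  by rewrite vdot_vscale exprMn -mul2n exprM c2.
move=> /(congr1 (fun x => (`|c| ^+ d)%:E * x)%E).
have cd0 : `|c| ^+ d != 0 by rewrite expf_neq0// normr_eq0 gt_eqF.
rewrite [X in _ = X -> _]muleA -EFinM mulfV// mul1e => <-.
rewrite muleA -EFinM; congr (_%:E * _)%E.
rewrite gtr0_norm// powRD; last by rewrite (gt_eqF s0) implybT.
rewrite powR_mulrn ?ltW// [RHS]mulrC; congr (_ * _).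
by rewrite mulrC powRrM powR12_sqrt ?ltW// powR_mulrn ?ltW.
Qed.

Lemma Gauss_vdot_moment w (n : nat) :
  (\int[lebesgue_vec d]_r (vdot w r ^+ n.*2 * expR (- enorm2 r))%:E =
   (Num.sqrt pi ^+ d * enorm w ^+ n.*2 * ((n.*2)`!%:R / (4 ^+ n * n`!%:R)))%:E)%E.
Proof.
have := @Gauss_projection R d w (fun u => (u : R) ^+ n.*2).
move=> /(_ (exprn_measurable _) (@even_power_ge0 n)).
have -> : (\int[leb R]_x (gauss_fun x * (enorm w * x) ^+ n.*2)%:E =
   (enorm w ^+ n.*2 * Gamma (n%:R + 2^-1))%:E)%E.
  rewrite EFinM -Gauss_even_moment -ge0_integralZl_EFinM.
  - by apply: eq_integral => x _; rewrite exprMn mulrCA [gauss_fun _ * _]mulrC.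
  - exact: even_power_ge0.
  - apply: measurable_funM; [exact: exprn_measurable|exact: measurable_gauss].
  - by move=> x; rewrite mulr_ge0 ?even_power_ge0 ?expR_ge0.
rewrite Gamma_nat_half.
move=> /(congr1 (fun x => ((Num.sqrt pi)^-1)%:E * x)%E).
have pi0 : Num.sqrt pi != 0 :> R by rewrite gt_eqF// sqrtr_gt0 pi_gt0.
rewrite muleA -EFinM mulVf// mul1e.
under eq_integral do rewrite mulrC.
move=> ->; rewrite -!EFinM; congr EFin.
by rewrite mulrC -!mulrA mulfV// mulr1.
Qed.

(** The Gaussian moment, computed by projection on one side and by the layer-cake
formula on the other, determines the integral over the unit ball. *)
Lemma integral_vdot_power_unit w (n : nat) :
  (\int[lebesgue_vec d]_(r in [set r | (enorm2 r <= 1)%R]) (vdot w r ^+ n.*2)%:E =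
   (Num.sqrt pi ^+ d * enorm w ^+ n.*2 * ((n.*2)`!%:R / (4 ^+ n * n`!%:R)) /
     Gamma (n%:R + d%:R / 2 + 1))%:E)%E.
Proof.
have p0 : 0 < n%:R + d%:R / 2 + 1 :> R by rewrite ltr_wpDl// addr_ge0// divr_ge0.
have G0 := Gamma_gt0 p0.
set V := (LHS).
have V0 : (0 <= V)%E.
  by apply: integral_ge0 => r _; rewrite lee_fin even_power_ge0.
have := integral_expRN_power (@measurable_enorm2 R d) (measurable_vdot_power w n.*2)
  (@enorm2_ge0 R d) (fun r => even_power_ge0 n (vdot w r)) V0
  (@integral_vdot_power_scale w n).
rewrite Gauss_vdot_moment eGammaE//.
move=> /(congr1 (fun x => x * ((Gamma (n%:R + d%:R / 2 + 1))^-1)%:E)%E).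
by rewrite -muleA -EFinM -EFinM mulfV ?gt_eqF// mule1 => <-.
Qed.

Lemma cball0_sublevel (t : R) : 0 <= t -> cball0 t = [set r : vec R d | enorm2 r <= t ^+ 2].
Proof.
move=> t0; apply/seteqP; split => r /=; rewrite /cball0/= -sqr_enorm => h.
  by rewrite ler_pXn2r// nnegrE sqrtr_ge0.
by move: h; rewrite ler_pXn2r// nnegrE sqrtr_ge0.
Qed.

Lemma enorm_powR (a : R) (r : vec R d) : enorm r `^ a = enorm2 r `^ (a / 2).
Proof. by rewrite mulrC powRrM powR12_sqrt// enorm2_ge0. Qed.

Lemma vdot_enorm2_eq0 w r : enorm2 r = 0 -> vdot w r = 0.
Proof.
move=> r0; rewrite /vdot big1// => i _.
have /eqP : \sum_(i < d) (tnth r i : R) ^+ 2 = 0 by [].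
rewrite psumr_eq0; last by move=> j _; exact: sqr_ge0.
by move=> /allP/(_ i (mem_index_enum _))/=; rewrite sqrf_eq0 => /eqP ->; rewrite mulr0.
Qed.

(** For n > 0 the power of w . r vanishes at the origin, where the weight
|r|^(-alpha) is singular. *)
Lemma integral_radial_moment w (n : nat) (alpha delta : R) :
  (0 < n)%N -> 0 <= alpha -> alpha < d%:R + 2 * n%:R -> 0 < delta ->
  (\int[lebesgue_vec d]_(r in cball0 delta) (vdot w r ^+ n.*2 * enorm r `^ (- alpha))%:E =
   (Num.sqrt pi ^+ d * enorm w ^+ n.*2 * ((n.*2)`!%:R / (4 ^+ n * n`!%:R)) /
     Gamma (n%:R + d%:R / 2) * (2 / (d%:R + 2 * n%:R - alpha)) *
     delta `^ (d%:R + 2 * n%:R - alpha))%:E)%E.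
Proof.
move=> n0 alpha0 alphan delta0.
have p0 : 0 < n%:R + d%:R / 2 :> R by rewrite ltr_pwDl ?ltr0n// divr_ge0.
have G0 := Gamma_gt0 p0.
rewrite cball0_sublevel ?ltW//.
under eq_integral do rewrite enorm_powR mulNr.
rewrite (integral_powRN_power (p := n%:R + d%:R / 2) (@measurable_enorm2 R d)
  (measurable_vdot_power w n.*2) (@enorm2_ge0 R d)
  (fun r => even_power_ge0 n (vdot w r)) _ (@integral_vdot_power_scale w n)).
- rewrite integral_vdot_power_unit GammaD1// -EFinM; congr EFin.
  rewrite -[delta ^+ 2]powR_mulrn ?ltW// -powRrM.
  rewrite (_ : 2%:R * (n%:R + d%:R / 2 - alpha / 2) = d%:R + 2 * n%:R - alpha); last by field.
  rewrite mulrA; congr (_ * _).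
  rewrite (_ : n%:R + d%:R / 2 - alpha / 2 = (d%:R + 2 * n%:R - alpha) / 2); last by field.
  have q0 : d%:R + 2 * n%:R - alpha != 0 by rewrite gt_eqF// subr_gt0.
  move: (_ * _ * _ : R) (d%:R + 2 * n%:R - alpha) q0 (n%:R + d%:R / 2) p0 G0 => M q q0 p p0 G0.
  by field; rewrite q0 !gt_eqF.
- by apply: integral_ge0 => r _; rewrite lee_fin even_power_ge0.
- by move=> r /(vdot_enorm2_eq0 w) ->; rewrite expr0n double_eq0 eqn0Ngt n0.
- by rewrite divr_ge0.
- lra.
- by rewrite exprn_gt0.
Qed.

End radial_moment.

(** * Reflection and odd integrands *)

Section reflection.
Context {R : realType} (d : nat).
Implicit Types r : vec R d.

Lemma vscaleN1K : involutive (@vscale R d (-1)).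
Proof.
by move=> r; apply: eq_from_tnth => i; rewrite !tnth_map mulrA mulrNN mulr1 mul1r.
Qed.

Lemma enorm_vscaleN1 r : enorm (vscale (-1) r) = enorm r.
Proof. by rewrite /enorm -![\sum_(i < d) _]/(enorm2 _) enorm2_vscale sqrrN expr1n mul1r. Qed.

(** The positive and negative parts have the same integral I, and the finite part
of I - I is 0 even when I is infinite. *)
Lemma Rintegral_odd (D : set (vec R d)) (f : vec R d -> R) :
  measurable D -> (forall r, D r -> D (vscale (-1) r)) ->
  measurable_fun setT f -> (forall r, f (vscale (-1) r) = - f r) ->
  \int[lebesgue_vec d]_(r in D) f r = 0.
Proof.
move=> mD Dsym mf fodd.
have N1 : -1 != 0 :> R by rewrite oppr_eq0 oner_eq0.
pose F := (EFin \o f) \_ D.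
have mF : measurable_fun setT F.
  by apply/(measurable_restrictT _ _).1 => //; apply: measurable_funTS; exact/measurable_EFinP.
have Fodd r : F (vscale (-1) r) = (- F r)%E.
  rewrite /F !patchE /= fodd.
  have [rD|rD] := boolP (r \in D).
    by rewrite mem_set//; apply: Dsym; exact/set_mem.
  rewrite memNset ?oppe0// => /Dsym; rewrite vscaleN1K => /mem_set.
  exact/negP.
have e : (\int[lebesgue_vec d]_r F^\- r = \int[lebesgue_vec d]_r F^\+ r)%E.
  have mFp : measurable_fun setT F^\+%E by exact: measurable_funepos.
  have := ge0_integral_vscale N1 mFp (fun r => funepos_ge0 F r).
  rewrite normrN1 expr1n invr1 mul1e => <-.
  by apply: eq_integral => r _; rewrite funeposE funenegE Fodd.
rewrite /Rintegral integral_mkcond -/F integralE e.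
by case: (\int[_]_x _ x)%E => [x| |] //=; rewrite subrr.
Qed.

Lemma measurable_enorm : measurable_fun setT (@enorm R d).
Proof.
rewrite (_ : enorm = fun r : vec R d => enorm2 r `^ 2^-1).
  by apply: (measurableT_comp (@measurable_powR R _)); exact: measurable_enorm2.
by apply/funext => r; rewrite powR12_sqrt// enorm2_ge0.
Qed.

Lemma measurable_cball0 (t : R) : measurable (cball0 t : set (vec R d)).
Proof. by apply: measurable_sublevel; exact: measurable_enorm. Qed.

(** The volume of a ball is the moment of order 0. *)
Lemma lebesgue_vec_cball0_lty (t : R) : 0 < t -> (lebesgue_vec d (cball0 t) < +oo)%E.
Proof.
move=> t0; have := @integral_vdot_power_scale R d [tuple 0 | i < d] 0 (t ^+ 2).
rewrite exprn_gt0// integral_vdot_power_unit => /(_ isT).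
rewrite -EFinM -cball0_sublevel ?ltW// double0.
under eq_integral do rewrite expr0.
rewrite integral_cst ?mul1e; last exact: measurable_cball0.
by move=> ->; rewrite ltry.
Qed.

End reflection.

(** * Partial sums of the cosine series *)

Section cosine_series.
Context {R : realType}.

Lemma cos_coeff'_val (x : R) n : cos_coeff' x n = (-1) ^+ n * x ^+ n.*2 / n.*2`!%:R.
Proof. by []. Qed.

Lemma cvg_cos_subr1 (x : R) :
  (fun N : nat => \sum_(1 <= n < N) cos_coeff' x n) @ \oo --> cos x - 1.
Proof.
have e : (fun N : nat => \sum_(1 <= n < N.+1) cos_coeff' x n) =
    (fun N : nat => series (cos_coeff' x) N.+1 - 1).
  apply/funext => N; rewrite /series/= [in RHS]big_ltn//.
  by rewrite cos_coeff'_val/= expr0 expr0 fact0 mul1r divr1 addrC addKr.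
rewrite -cvg_shiftS/= e; apply: cvgB; last exact: cvg_cst.
by rewrite (cvg_shiftS (series (cos_coeff' x))); exact: cvg_cos_coeff'.
Qed.

(** The factor x^2, and not just the boundedness of the partial sums, is what
compensates the singular weight in the dominated convergence argument. Each
term satisfies x^(2n+2) / (2n+2)! <= x^2 x^(2n) / (2n)!, and the right-hand
sides are x^2 times terms of the exponential series of |x|. *)
Lemma norm_sum_cos_coeff (x : R) (N : nat) :
  `|\sum_(1 <= n < N) cos_coeff' x n| <= x ^+ 2 * expR `|x|.
Proof.
have lim0 M : series (exp_coeff `|x|) M <= expR `|x|.
  rewrite /expR; apply: nondecreasing_cvgn_le; last exact: is_cvg_series_exp_coeff.
  by apply: nondecreasing_series => n _ _; exact: exp_coeff_ge0.
case: N => [|N]; first by rewrite big_nil normr0 mulr_ge0 ?sqr_ge0 ?expR_ge0.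
apply: le_trans (ler_wpM2l (sqr_ge0 x) (lim0 N.*2)).
rewrite big_add1/=; elim: N => [|N IH].
  by rewrite big_nil normr0 mulr_ge0 ?sqr_ge0// /series/= big_nil.
rewrite big_nat_recr//=; apply: le_trans (ler_normD _ _) _.
rewrite doubleS /series/= !big_nat_recr//= -!/(series _ _) -addrA mulrDr lerD//.
apply: (@le_trans _ _ (x ^+ 2 * exp_coeff `|x| N.*2)); last first.
  by rewrite ler_wpM2l ?sqr_ge0// lerDl exp_coeff_ge0.
rewrite cos_coeff'_val 2!normrM 2!normrX normrN1 expr1n mul1r normfV normr_nat.
rewrite doubleS 2!exprS /exp_coeff/= mulrA -expr2 real_normK ?num_real// -mulrA.
rewrite ler_wpM2l ?sqr_ge0// ler_wpM2l ?exprn_ge0// lef_pV2 ?posrE ?ltr0n ?fact_gt0//.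
by rewrite ler_nat leq_fact// ltnW.
Qed.

End cosine_series.

(** * Term-by-term integration *)

Lemma lt_exponent (R : realType) (d n : nat) (alpha : R) :
  (0 < n)%N -> alpha < d%:R + 2 -> alpha < d%:R + 2 * n%:R.
Proof.
move=> n0 alpha_lt; apply: lt_le_trans alpha_lt _.
by rewrite lerD2l ler_peMr// ler1n.
Qed.

Section cosine_transform.
Context {R : realType} (d : nat).
Variables (w : vec R d) (alpha delta : R).
Hypothesis alpha_ge0 : 0 <= alpha.
Hypotheses (alpha_lt : alpha < d%:R + 2) (delta_gt0 : 0 < delta).

Lemma norm_vdot_le r : `|vdot w r| <= (\sum_(i < d) `|tnth w i : R|) * enorm r.
Proof.
rewrite /vdot mulr_suml; apply: le_trans (ler_norm_sum _ _ _) _.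
apply: ler_sum => i _; rewrite normrM ler_wpM2l// -[X in X <= _]sqrtr_sqr.
rewrite ler_sqrt ?enorm2_ge0// (bigD1 i)//= lerDl.
by apply: sumr_ge0 => j _; exact: sqr_ge0.
Qed.

(** The value found in [integral_radial_moment]. *)
Definition radial_moment (n : nat) : R :=
  Num.sqrt pi ^+ d * enorm w ^+ n.*2 * ((n.*2)`!%:R / (4 ^+ n * n`!%:R)) /
     Gamma (n%:R + d%:R / 2) * (2 / (d%:R + 2 * n%:R - alpha)) *
     delta `^ (d%:R + 2 * n%:R - alpha).

Lemma measurable_vdot_powR (n : nat) :
  measurable_fun setT (fun r : vec R d => vdot w r ^+ n * enorm r `^ (- alpha)).
Proof.
apply: measurable_funM; first exact: measurable_vdot_power.
exact: (measurableT_comp (@measurable_powR R _) (@measurable_enorm R d)).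
Qed.

Lemma integrable_radial_moment n : (0 < n)%N ->
  (lebesgue_vec d).-integrable (cball0 delta)
    (fun r => (vdot w r ^+ n.*2 * enorm r `^ (- alpha))%:E).
Proof.
move=> n0; apply/integrableP; split.
  by apply/measurable_EFinP; apply: measurable_funTS; exact: measurable_vdot_powR.
under eq_integral do rewrite gee0_abs ?lee_fin ?mulr_ge0 ?even_power_ge0 ?powR_ge0//.
by rewrite integral_radial_moment ?(lt_exponent _ alpha_lt)// ltry.
Qed.

Definition cosine_integrand (r : vec R d) : R :=
  enorm r `^ (- alpha) * (cos (vdot w r) - 1).

Definition cosine_term (n : nat) : R :=
  (-1) ^+ n / n.*2`!%:R * radial_moment n.

(** Dominated convergence, with bound exp(W delta) (w . r)^2 |r|^(-alpha), where W
is the sum of the |w_i|, so that |w . r| <= W delta on the ball. *)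
Lemma cosine_integral :
  (lebesgue_vec d).-integrable (cball0 delta) (EFin \o cosine_integrand) /\
  (fun N : nat => \sum_(1 <= n < N) cosine_term n) @ \oo -->
    \int[lebesgue_vec d]_(r in cball0 delta) cosine_integrand r.
Proof.
have mB := measurable_cball0 (d := d) delta.
pose h n r : \bar R := (((-1) ^+ n / n.*2`!%:R)%:E *
  (vdot w r ^+ n.*2 * enorm r `^ (- alpha))%:E)%E.
have mh n : measurable_fun setT (h n).
  apply: measurable_funeM; apply/measurable_EFinP; exact: measurable_vdot_powR.
pose f_ N r : \bar R := (\sum_(1 <= n < N) h n r)%E.
have f_E N r : f_ N r =
    (enorm r `^ (- alpha) * \sum_(1 <= n < N) cos_coeff' (vdot w r) n)%:E.
  rewrite /f_ /h mulr_sumr -sumEFin; apply: eq_bigr => n _.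
  by rewrite -EFinM cos_coeff'_val; congr EFin; ring.
pose W := \sum_(i < d) `|tnth w i : R|.
pose g r : \bar R := ((expR (W * delta))%:E *
  (vdot w r ^+ 1.*2 * enorm r `^ (- alpha))%:E)%E.
have ig : (lebesgue_vec d).-integrable (cball0 delta) g.
  by apply: integrableZl => //; exact: integrable_radial_moment.
have mcos : measurable_fun setT cosine_integrand.
  apply: measurable_funM.
    exact: (measurableT_comp (@measurable_powR R _) (@measurable_enorm R d)).
  apply: measurable_funB => //.
  apply: (measurableT_comp (continuous_measurable_fun (@continuous_cos R))).
  exact: measurable_vdot.
have [|||||iC _ cC] := @dominated_convergence _ _ _ (lebesgue_vec d) (cball0 delta) mB
  f_ (EFin \o cosine_integrand) g.
- by move=> N; apply: measurable_funTS; exact: emeasurable_sum.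
- by apply: measurable_funTS; exact/measurable_EFinP.
- apply: aeW => r _; under eq_cvg do rewrite f_E.
  apply: cvg_EFin; first exact: nearW.
  by apply: cvgM; [exact: cvg_cst|exact: cvg_cos_subr1].
- exact: ig.
- apply: aeW => r N rB; rewrite f_E /g -EFinM abse_EFin lee_fin normrM.
  rewrite ger0_norm ?powR_ge0// [X in _ <= X]mulrA [X in _ <= X]mulrC.
  rewrite ler_wpM2l ?powR_ge0//.
  apply: le_trans (norm_sum_cos_coeff _ _) _.
  rewrite mulrC ler_wpM2r ?sqr_ge0// ler_expR.
  apply: le_trans (norm_vdot_le r) _.
  by rewrite ler_wpM2l//; apply: sumr_ge0.
split => //.
have e : (fun N : nat => \int[lebesgue_vec d]_(r in cball0 delta) f_ N r)%E =
    EFin \o (fun N : nat => \sum_(1 <= n < N) cosine_term n).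
  (* The term n = 0 must go: |r|^(-alpha) alone need not be integrable. *)
  apply/funext => N /=; rewrite /f_ big_add1 -sumEFin.
  under eq_integral do rewrite big_add1.
  rewrite integral_sum//.
    apply: eq_bigr => n _; rewrite integralZl//; last exact: integrable_radial_moment.
    by rewrite integral_radial_moment ?(lt_exponent _ alpha_lt)// -EFinM.
  by move=> n; apply: integrableZl => //; exact: integrable_radial_moment.
move: cC; rewrite e => cC.
have : (EFin \o (fun N : nat => \sum_(1 <= n < N) cosine_term n)) N @[N --> \oo] -->
    (\int[lebesgue_vec d]_(r in cball0 delta) cosine_integrand r)%:E.
  by rewrite /Rintegral fineK//; exact: integrable_fin_num.
by move=> /fine_cvgP[_].
Qed.

End cosine_transform.

(** * Comparison of the two series *)

Lemma pochhammer_ratio (R : realType) (a : R) (n : nat) : 0 < a ->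
  pochhammer a n / pochhammer (a + 1) n = a / (a + n%:R).
Proof.
move=> a0; have an0 : 0 < a + n%:R by rewrite ltr_wpDr.
rewrite /pochhammer addrAC !GammaD1//.
have := Gamma_gt0 a0; have := Gamma_gt0 an0.
move: (Gamma _) (Gamma _) => x y x0 y0.
by field; rewrite !gt_eqF.
Qed.

Section series_terms.
Context {R : realType} (d : nat).
Variables (w : vec R d) (alpha delta : R).
Hypotheses (alpha_lt : alpha < d%:R + 2) (delta_gt0 : 0 < delta).

Let z : R := - (enorm w ^+ 2 * delta ^+ 2) / 4.

Definition symbol_term (n : nat) : R :=
  z ^+ n / (n`!%:R * Gamma (n%:R + d%:R / 2)) *
    ((d%:R + 2 - alpha) / (d%:R + 2 * n%:R - alpha)).

Definition kernel_constant : R :=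
  2 * Gamma (d%:R / 2 + 1) * (d%:R + 2 - alpha) /
  (pi `^ (d%:R / 2) * delta `^ (d%:R + 2 - alpha)).

Lemma powR_half_pi : pi `^ (d%:R / 2) = Num.sqrt pi ^+ d :> R.
Proof. by rewrite mulrC powRrM powR12_sqrt ?pi_ge0// powR_mulrn// sqrtr_ge0. Qed.

(** The factorial (2n)! and the powers of pi cancel, leaving a power of
-|w|^2 delta^2 / 4. *)
Lemma cosine_termE n : (0 < n)%N ->
  kernel_constant * cosine_term w alpha delta n =
  4 * Gamma (d%:R / 2 + 1) / delta ^+ 2 * symbol_term n.
Proof.
move=> n0.
have q0 : d%:R + 2 * n%:R - alpha != 0.
  by rewrite gt_eqF// subr_gt0 lt_exponent.
have e : delta `^ (d%:R + 2 * n%:R - alpha) =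
    delta `^ (d%:R + 2 - alpha) * delta ^+ n.*2 / delta ^+ 2.
  rewrite -!powR_mulrn ?ltW// -powRD ?(gt_eqF delta_gt0) ?implybT//.
  rewrite -powRB ?(gt_eqF delta_gt0) ?implybT//.
  by congr (_ `^ _); rewrite -mul2n natrM; ring.
have D0 : delta `^ (d%:R + 2 - alpha) != 0 by rewrite gt_eqF// powR_gt0.
have P0 : Num.sqrt pi ^+ d != 0 :> R by rewrite expf_neq0// gt_eqF// sqrtr_gt0 pi_gt0.
have G0 : Gamma (n%:R + d%:R / 2) != 0 :> R.
  by rewrite gt_eqF// Gamma_gt0// ltr_pwDl ?ltr0n// divr_ge0.
have f2 : (n.*2)`!%:R != 0 :> R by rewrite pnatr_eq0 -lt0n fact_gt0.
have f1 : n`!%:R != 0 :> R by rewrite pnatr_eq0 -lt0n fact_gt0.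
have p4 : 4 ^+ n != 0 :> R by rewrite expf_neq0.
have zE : z ^+ n = (-1) ^+ n * enorm w ^+ n.*2 * delta ^+ n.*2 / 4 ^+ n.
  have -> : z = -1 * (enorm w ^+ 2 * delta ^+ 2) / 4 by rewrite mulN1r.
  by rewrite 3!exprMn exprVn -mul2n (exprM delta) (exprM (enorm w)) !mulrA.
rewrite /cosine_term /radial_moment /kernel_constant /symbol_term zE e powR_half_pi.
move: (delta `^ _) D0 (Num.sqrt pi ^+ d) P0 (Gamma (_ + _ / 2)) G0 (Gamma _) ((n.*2)`!%:R) f2
  (n`!%:R) f1 (4 ^+ n) p4 (delta ^+ n.*2) (enorm w ^+ n.*2) ((-1) ^+ n).
have dl0 := lt0r_neq0 delta_gt0.
move=> D D0 P P0 G G0 G1 x2 f2 x1 f1 x4 p4 y1 y2 y3.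
by field; rewrite q0 G0 f1 p4 dl0 f2 D0.
Qed.

(** The upper parameters 1 and a = (d + 2 - alpha) / 2 are each one less than a
lower parameter, so their Pochhammer quotients collapse to 1 / (1 + n) and
a / (a + n). *)
Lemma hypergeometric_termE n :
  - enorm w ^+ 2 * hypergeometric_term [:: 1; (d%:R + 2 - alpha) / 2]
     [:: 2; (d%:R + 2) / 2; (d%:R + 4 - alpha) / 2] z n =
  4 * Gamma (d%:R / 2 + 1) / delta ^+ 2 * symbol_term n.+1.
Proof.
rewrite /hypergeometric_term /symbol_term big_cons big_seq1 2!big_cons big_seq1.
set a := (d%:R + 2 - alpha) / 2.
have -> : (d%:R + 4 - alpha) / 2 = a + 1 by rewrite /a; field.
have a0 : 0 < a by rewrite divr_gt0// subr_gt0.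
have r1 : pochhammer 1 n / pochhammer 2 n = 1 / (1 + n%:R) :> R.
  exact: (pochhammer_ratio n (@ltr01 R)).
have ra := pochhammer_ratio n a0.
transitivity (- enorm w ^+ 2 * ((pochhammer 1 n / pochhammer 2 n) *
    (pochhammer a n / pochhammer (a + 1) n) / pochhammer ((d%:R + 2) / 2) n) *
    (z ^+ n / n`!%:R)).
  move: (pochhammer 1 n) (pochhammer 2 n) (pochhammer a n) (pochhammer (a + 1) n)
    (pochhammer ((d%:R + 2) / 2) n) => x1 x2 x3 x4 x5.
  by rewrite !invfM; ring.
rewrite r1 ra.
have -> : pochhammer ((d%:R + 2) / 2) n =
    Gamma (n.+1%:R + d%:R / 2) / Gamma (d%:R / 2 + 1) :> R.
  rewrite /pochhammer (_ : (d%:R + 2) / 2 + n%:R = n.+1%:R + d%:R / 2).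
    by rewrite (_ : (d%:R + 2) / 2 = d%:R / 2 + 1)//; field.
  by rewrite -natr1; field.
have q0 : d%:R + 2 * n.+1%:R - alpha != 0.
  by rewrite gt_eqF// subr_gt0 lt_exponent.
have -> : a / (a + n%:R) = (d%:R + 2 - alpha) / (d%:R + 2 * n.+1%:R - alpha).
  have an0 : a + n%:R != 0 by rewrite gt_eqF// ltr_wpDr.
  apply/eqP; rewrite eqr_div//; apply/eqP; rewrite /a -natr1.
  by field.
have G0 : Gamma (d%:R / 2 + 1) != 0 :> R.
  by rewrite gt_eqF// Gamma_gt0// ltr_wpDl// divr_ge0.
have G1 : Gamma (n.+1%:R + d%:R / 2) != 0 :> R.
  by rewrite gt_eqF// Gamma_gt0// ltr_pwDl ?ltr0n// divr_ge0.
have f1 : n`!%:R != 0 :> R by rewrite pnatr_eq0 -lt0n fact_gt0.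
have n1 : n.+1%:R != 0 :> R by rewrite pnatr_eq0.
have dl0 := lt0r_neq0 delta_gt0.
rewrite (exprS z) factS (natrM _ n.+1) nat1r.
move: (n.+1%:R) n1 (Gamma (d%:R / 2 + 1)) G0 (Gamma _) G1 (z ^+ n) (n`!%:R) f1
  (d%:R + 2 * _ - alpha) q0 => m m0 g g0 g1 g10 y x x0 q q0.
by rewrite /z; field; rewrite dl0 g0 g10 x0 q0 m0.
Qed.

End series_terms.

(** * The symbol *)

Section symbol.
Context {R : realType} (d : nat).
Variables (k : d.-tuple int) (alpha delta : R).
Hypothesis alpha_ge0 : 0 <= alpha.
Hypotheses (alpha_lt : alpha < d%:R + 2) (delta_gt0 : 0 < delta).

Let w : vec R d := vec_of_int k.
Let f := symbol_integrand delta alpha k.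

Lemma Re_symbol_integrand r :
  complex.Re (f r) = rho d delta alpha (enorm r) * (cos (vdot w r) - 1).
Proof. by rewrite /f /symbol_integrand/= mul0r subr0. Qed.

Lemma Im_symbol_integrand r :
  complex.Im (f r) = rho d delta alpha (enorm r) * sin (vdot w r).
Proof. by rewrite /f /symbol_integrand/= mul0r addr0 subr0. Qed.

Lemma rho_enorm (r : vec R d) : cball0 delta r ->
  rho d delta alpha (enorm r) = kernel_constant d alpha delta * enorm r `^ (- alpha).
Proof.
move=> rB; rewrite /rho indicE mem_set/=; last by rewrite in_itv/= sqrtr_ge0.
by rewrite mulr1 powRN invfM mulrA.
Qed.

Lemma measurable_rho_enorm :
  measurable_fun setT (fun r : vec R d => rho d delta alpha (enorm r)).
Proof.
have menorm := @measurable_enorm R d.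
have -> : (fun r : vec R d => rho d delta alpha (enorm r)) =
    (fun r => kernel_constant d alpha delta * enorm r `^ (- alpha) *
       \1_(cball0 delta) r).
  apply/funext => r; have [rB|rB] := pselect (cball0 delta r).
    by rewrite rho_enorm// indicE mem_set// mulr1.
  rewrite indicE memNset// mulr0 /rho indicE memNset ?mulr0//= in_itv/=.
  by move=> /andP[].
apply: measurable_funM; last first.
  by apply: measurable_indic; exact: measurable_cball0.
by apply: measurable_funM => //; exact: (measurableT_comp (@measurable_powR R _) menorm).
Qed.

Lemma measurable_Im_symbol : measurable_fun setT (fun r => complex.Im (f r)).
Proof.
rewrite (_ : (fun r => _) = fun r => rho d delta alpha (enorm r) * sin (vdot w r)).
  apply: measurable_funM; first exact: measurable_rho_enorm.
  apply: (measurableT_comp (continuous_measurable_fun (@continuous_sin R))).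
  exact: measurable_vdot.
by apply/funext => r; exact: Im_symbol_integrand.
Qed.

Lemma Im_symbol_odd r : complex.Im (f (vscale (-1) r)) = - complex.Im (f r).
Proof.
by rewrite !Im_symbol_integrand enorm_vscaleN1 vdot_vscale mulN1r sinN mulrN.
Qed.

Lemma annulus_Im_symbol (eps : R) :
  annulus_integral delta (fun r => complex.Im (f r)) eps = 0.
Proof.
apply: Rintegral_odd.
- by apply: measurableD; exact: measurable_cball0.
- by move=> r; rewrite /cball0/= enorm_vscaleN1.
- exact: measurable_Im_symbol.
- exact: Im_symbol_odd.
Qed.

Lemma Im_symbol_ball_integral : ball_integral delta (fun r => complex.Im (f r)) = 0.
Proof.
rewrite /ball_integral; case: ifP => _.
  apply: Rintegral_odd.
  - exact: measurable_cball0.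
  - by move=> r; rewrite /cball0/= enorm_vscaleN1.
  - exact: measurable_Im_symbol.
  - exact: Im_symbol_odd.
rewrite (_ : annulus_integral _ _ = cst 0); first exact: lim_cst.
by apply/funext => e; exact: annulus_Im_symbol.
Qed.

(** On an annulus the integrand is bounded, and all the annulus integrals are 0, so
the principal value exists even where the integral over the ball diverges. *)
Lemma Im_symbol_exists : ball_integral_exists delta (fun r => complex.Im (f r)).
Proof.
right; split; last first.
  rewrite (_ : annulus_integral _ _ = cst 0); first exact: is_cvg_cst.
  by apply/funext => e; exact: annulus_Im_symbol.
move=> e e0; apply: measurable_bounded_integrable.
- by apply: measurableD; exact: measurable_cball0.
- apply: le_lt_trans (lebesgue_vec_cball0_lty d delta_gt0).
  apply: le_measure; rewrite ?inE.
  + by apply: measurableD; exact: measurable_cball0.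
  + exact: measurable_cball0.
  + exact: subDsetl.
- by apply: measurable_funTS; exact: measurable_Im_symbol.
- exists (`|kernel_constant d alpha delta| * e `^ (- alpha)); split; first exact: num_real.
  move=> M CM r [rB /negP]; rewrite -ltNge => er.
  apply: le_trans (ltW CM); rewrite Im_symbol_integrand rho_enorm// !normrM -mulrA.
  rewrite ler_wpM2l// -[X in _ <= X]mulr1 ler_pM//.
    rewrite ger0_norm ?powR_ge0// !powRN lef_pV2 ?posrE ?powR_gt0//.
      by rewrite ge0_ler_powR// ?nnegrE ltW// (lt_trans e0).
    exact: lt_trans er.
  by rewrite ler_norml sin_geN1 sin_le1.
Qed.

Lemma Re_symbolE : {in cball0 delta, (fun r => complex.Re (f r)) =1
  (fun r => kernel_constant d alpha delta * cosine_integrand w alpha r)}.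
Proof.
by move=> r /set_mem rB; rewrite Re_symbol_integrand rho_enorm// /cosine_integrand mulrA.
Qed.

(** cos x - 1 vanishes to second order at 0, so the real part needs no principal
value. *)
Lemma Re_symbol_integrable :
  (lebesgue_vec d).-integrable (cball0 delta) (EFin \o (fun r => complex.Re (f r))).
Proof.
have [ic _] := cosine_integral w alpha_ge0 alpha_lt delta_gt0.
have := integrableZl (measurable_cball0 delta) (kernel_constant d alpha delta) ic.
apply: eq_integrable; first exact: measurable_cball0.
by move=> r rB; rewrite [RHS](congr1 EFin (Re_symbolE rB)) EFinM.
Qed.

Let A : R := 4 * Gamma (d%:R / 2 + 1) / delta ^+ 2.

Lemma cvg_symbol_series :
  (fun N : nat => \sum_(1 <= n < N) symbol_term w alpha delta n) @ \oo -->
  ball_integral delta (fun r => complex.Re (f r)) / A.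
Proof.
have A0 : A != 0.
  by rewrite gt_eqF// divr_gt0 ?exprn_gt0// mulr_gt0// Gamma_gt0// ltr_wpDl// divr_ge0.
have [ic cc] := cosine_integral w alpha_ge0 alpha_lt delta_gt0.
have -> : ball_integral delta (fun r => complex.Re (f r)) =
    kernel_constant d alpha delta *
    \int[lebesgue_vec d]_(r in cball0 delta) cosine_integrand w alpha r.
  rewrite /ball_integral Re_symbol_integrable -RintegralZl//.
    exact: eq_Rintegral Re_symbolE.
  exact: measurable_cball0.
have -> : (fun N : nat => \sum_(1 <= n < N) symbol_term w alpha delta n) =
    (fun N : nat => kernel_constant d alpha delta *
      (\sum_(1 <= n < N) cosine_term w alpha delta n) / A).
  apply/funext => N; rewrite mulr_sumr mulr_suml; apply: eq_big_nat => n /andP[n0 _].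
  by rewrite cosine_termE// -/A mulrAC mulfV// mul1r.
by apply: cvgM; [apply: cvgM => //; exact: cvg_cst|exact: cvg_cst].
Qed.

End symbol.

Lemma series_symbol_termS (R : realType) (d : nat) (w : vec R d)
    (alpha delta : R) (N : nat) :
  alpha < d%:R + 2 -> 0 < delta ->
  - enorm w ^+ 2 * series (hypergeometric_term [:: 1; (d%:R + 2 - alpha) / 2]
     [:: 2; (d%:R + 2) / 2; (d%:R + 4 - alpha) / 2]
     (- (enorm w ^+ 2 * delta ^+ 2) / 4)) N =
  4 * Gamma (d%:R / 2 + 1) / delta ^+ 2 *
    \sum_(1 <= n < N.+1) symbol_term w alpha delta n.
Proof.
move=> alpha_lt delta_gt0; rewrite big_add1/= 2!mulr_sumr.
by apply: eq_bigr => n _; exact: hypergeometric_termE.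
Qed.

Theorem mainTheorem3 (R : realType) (d : nat) (delta alpha : R)
    (k : d.-tuple int)
    (hd : (0 < d)%N) (hdelta : 0 < delta)
    (halpha0 : 0 <= alpha) (halpha : alpha < d%:R + 2) :
  let kn : R := enorm (vec_of_int k) in
  let z : R := - (kn ^+ 2 * delta ^+ 2) / 4 in
  let term (n : nat) : R :=
    z ^+ n / (n`!%:R * Gamma (n%:R + d%:R / 2)) *
    ((d%:R + 2 - alpha) / (d%:R + 2 * n%:R - alpha)) in
  let a : seq R := [:: 1; (d%:R + 2 - alpha) / 2] in
  let b : seq R := [:: 2; (d%:R + 2) / 2; (d%:R + 4 - alpha) / 2] in
  [/\ lambda_exists delta alpha k,
      cvgn (fun N : nat => \sum_(1 <= n < N) term n),
      cvgn (series (hypergeometric_term a b z)),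
      lambda delta alpha k =
        (4 * Gamma (d%:R / 2 + 1) / delta ^+ 2 *
         limn (fun N : nat => \sum_(1 <= n < N) term n))%:C &
      lambda delta alpha k = (- kn ^+ 2 * hypergeometric a b z)%:C].
Proof.
move=> kn z term a b.
have cS := cvg_symbol_series (k := k) halpha0 halpha hdelta.
have A0 : 0 < 4 * Gamma (d%:R / 2 + 1) / delta ^+ 2 :> R.
  by rewrite divr_gt0 ?exprn_gt0// mulr_gt0// Gamma_gt0// ltr_wpDl// divr_ge0.
have hE N := @series_symbol_termS R d (vec_of_int k) alpha delta N halpha hdelta.
have cT : cvgn (fun N : nat => \sum_(1 <= n < N) term n).
  by apply/cvg_ex; eexists; exact: cS.
have cST : (fun N : nat => - kn ^+ 2 * series (hypergeometric_term a b z) N) @ \oo -->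
    4 * Gamma (d%:R / 2 + 1) / delta ^+ 2 *
      limn (fun N : nat => \sum_(1 <= n < N) term n).
  rewrite (_ : (fun N => _) = (fun N : nat => 4 * Gamma (d%:R / 2 + 1) / delta ^+ 2 *
      \sum_(1 <= n < N.+1) term n)); last by apply/funext => N; exact: hE.
  apply: cvgM; first exact: cvg_cst.
  by rewrite (cvg_shiftS (fun N : nat => \sum_(1 <= n < N) term n)).
have cH : cvgn (series (hypergeometric_term a b z)).
  (* For kn = 0 the identity between the terms says nothing about the
     hypergeometric series, but all its terms after the first are 0. *)
  have [kn0|kn0] := eqVneq kn 0.
    have z0 : z = 0 by rewrite /z kn0 expr0n mul0r oppr0 mul0r.
    apply/cvg_ex; exists (hypergeometric_term a b z 0%N); rewrite -cvg_shiftS.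
    rewrite (_ : (fun N => _) = cst (hypergeometric_term a b z 0%N)); first exact: cvg_cst.
    apply/funext => N; rewrite /series/= big_nat_recl// big1 ?addr0// => n _.
    by rewrite /hypergeometric_term z0 expr0n mul0r mulr0.
  have kn2 : - kn ^+ 2 != 0 by rewrite oppr_eq0 sqrf_eq0.
  rewrite (_ : series _ = fun N => (- kn ^+ 2)^-1 *
      (- kn ^+ 2 * series (hypergeometric_term a b z) N)); last first.
    by apply/funext => N; rewrite mulKf.
  by apply: is_cvgM; [exact: is_cvg_cst|apply/cvg_ex; eexists; exact: cST].
have lambdaE : lambda delta alpha k = (4 * Gamma (d%:R / 2 + 1) / delta ^+ 2 *
         limn (fun N : nat => \sum_(1 <= n < N) term n))%:C.
  rewrite /lambda /complex_ball_integral Im_symbol_ball_integral//.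
  by rewrite (cvg_lim (@Rhausdorff R) cS) mulrC divfK ?gt_eqF.
split => //.
- split; last exact: Im_symbol_exists.
  by left; exact: Re_symbol_integrable.
- rewrite lambdaE; congr (_%:C); rewrite -(cvg_lim (@Rhausdorff R) cST).
  by apply/cvg_lim => //; apply: cvgM; [exact: cvg_cst|exact: cH].
Qed.
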